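(* Suppose the threshold of the oracle is $c=O(m^q)$, where $0\le q<1$. Then: (1) for any $T$ and $m$ with $T\le m$, there exist $m'=\Theta(m)$ and $T'=\Theta(T)$ such that any one-pass arbitrary order streaming algorithm (with access to the oracle) that distinguishes between $m'$-edge graphs with $0$ triangles and $m'$-edge graphs with $T'$ triangles with probability at least $2/3$ requires $\Omega(m/\sqrt{T})$ space; (2) for any $T$ and $m$ with $T=\Omega(m^{1+\delta})$ where $\max(0,q-\frac12)\le\delta<\frac12$, there exist $m'=\Theta(m)$ and $T'=\Theta(T)$ such that any one-pass arbitrary order streaming algorithm (with access to the oracle) that distinguishes between $m'$-edge graphs with $0$ and $T'$ triangles with probability at least $2/3$ requires $\Omega(m^{3/2}/T)$ space.
   Context: Graphs are simple and undirected; $m$ is the number of edges and $T$ the number of triangles. Arbitrary order model: edges arrive one at a time in arbitrary order, one pass. For an edge $uv$, $N_{uv}$ is the number of triangles containing $u$ and $v$. The algorithm has access to a perfect heavy edge oracle with threshold $c$: on each edge $uv$ it correctly reports whether $uv$ is heavy, meaning $N_{uv}\ge T/c$ (it is assumed that $c=o(m)$ and $T/c>1$).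
   Formalization: Part (2) also assumes T = O(m^{3/2}), true of every graph with m edges and T triangles; otherwise no m'-edge graph with T' triangles exists and the claim fails. ''Heavy'' means N_uv ≥ T'/c on both the triangle-free inputs and those with T' triangles. *)

(* Defs.v *)
From HB Require Import structures.
From mathcomp Require Import all_boot all_order all_algebra.
From mathcomp Require Import reals exp.

Set Implicit Arguments.
Unset Strict Implicit.
Unset Printing Implicit Defensive.

Import Order.TTheory GRing.Theory Num.Theory.
Local Open Scope ring_scope.

Record sgraph (V : finType) := SGraph {
  edges : {set {set V}};
  edgesP : forall e : {set V}, e \in edges -> #|e| = 2%N
}.

Definition triangles (V : finType) (G : sgraph V) : {set {set V}} :=
  [set t : {set V} | (#|t| == 3%N) &&
     [forall e : {set V}, ((e \subset t) && (#|e| == 2%N)) ==> (e \in edges G)]].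

Definition tri_edge (V : finType) (G : sgraph V) (e : {set V}) : nat :=
  #|[set t in triangles G | e \subset t]|.

(* The numerator T is a parameter and not #|triangles G|: the same threshold
   T / c must apply to the triangle-free inputs and to those with T triangles
   (with #|triangles G| every edge of a triangle-free graph would be heavy).
   Sets of vertices that are not edges of G are reported as not heavy. *)
Definition heavy_oracle (R : realType) (V : finType) (G : sgraph V)
    (T : nat) (c : R) (e : {set V}) : bool :=
  (e \in edges G) && (T%:R / c <= (tri_edge G e)%:R).

(* Randomised one-pass algorithms whose memory between two stream items is a
   string of s bits. Only this memory is charged: the algorithm is non-uniform
   (step may depend on the position in the stream), its random seed is free, and
   it may query the oracle on any set of vertices at any time. This covers all
   the usual, more restricted, models of a one-pass algorithm. A finite seed
   space is enough because a stream of bounded length has finitely many runs. *)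
Record streaming_alg (R : realType) (V : finType) (s : nat) := StreamingAlg {
  seed : finType;
  seed_prob : seed -> R;
  seed_prob_ge0 : forall w, 0 <= seed_prob w;
  seed_prob_sum1 : \sum_w seed_prob w = 1;
  init : seed -> s.-tuple bool;
  step : seed -> ({set V} -> bool) -> nat -> s.-tuple bool -> {set V} ->
         s.-tuple bool;
  output : seed -> ({set V} -> bool) -> s.-tuple bool -> bool
}.

Section Run.
Variables (R : realType) (V : finType) (s : nat) (A : streaming_alg R V s).

Fixpoint run_from (w : seed A) (O : {set V} -> bool) (i : nat)
    (mem : s.-tuple bool) (es : seq {set V}) : s.-tuple bool :=
  if es is e :: es' then run_from w O i.+1 (step w O i mem e) es' else mem.

Definition answer (w : seed A) (O : {set V} -> bool) (es : seq {set V}) : bool :=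
  output w O (run_from w O 0 (init w) es).

Definition prob_answer (O : {set V} -> bool) (es : seq {set V}) (b : bool) : R :=
  \sum_(w : seed A | answer w O es == b) seed_prob w.

Definition distinguishes (m T : nat) (c : R) : Prop :=
  forall (G : sgraph V) (es : seq {set V}),
    #|edges G| = m -> perm_eq es (enum (edges G)) ->
    (#|triangles G| = 0%N ->
       2 / 3 <= prob_answer (heavy_oracle G T c) es false) /\
    (#|triangles G| = T ->
       2 / 3 <= prob_answer (heavy_oracle G T c) es true).
End Run.

(* With at least 2 * m vertices, every graph with m edges occurs on V, up to
   isolated vertices. *)
Definition requires_space (R : realType) (m T : nat) (c B : R) : Prop :=
  forall (V : finType) (s : nat) (A : streaming_alg R V s),
    (2 * m <= #|V|)%N -> distinguishes A m T c -> B <= s%:R.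

Definition within_factor (R : realType) (C : R) (x y : nat) : Prop :=
  C^-1 * x%:R <= y%:R <= C * x%:R.

(* Main.v *)
Require Import Defs.
From HB Require Import structures.
From mathcomp Require Import all_boot all_order all_algebra.
From mathcomp Require Import boolp reals exp.
From mathcomp Require Import ring lra zify.

(** Alice holds bits [x_a], [y_b] for [a, b < n] and joins [t] centres to [k]
    copies of a left vertex labelled [(a, x_a)] and of a right vertex labelled
    [(b, y_b)].  Bob holds [P] disjoint pairs [(a_j, b_j)] with bits [w_j], and
    joins the copies of [(a_j, u)] to those of [(b_j, u + w_j)] for both values
    of [u].  If [w_j = x_(a_j) + y_(b_j)] for all [j], there are [t P k^2]
    triangles; if every [w_j] is flipped, there are none.  No edge lies in more
    than [max(t, k)] triangles, which is below the threshold, so the oracle is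
    constantly [false].

    It remains to bound a hidden-matching communication problem.  Conditioning
    on an [s]-bit message leaves a density [f] on the cube, and the squared
    biases of the parities [x_a + y_b] sum to [O((s + 1)^2)]: test [f] against
    its own bilinear part, whose moments are controlled by Khintchine's
    inequality.  Hence some pair is almost unbiased; choosing such pairs one
    after the other, [P] parities look uniform as long as
    [(s + 1)^2 P] is small compared with [n^2].  It is the conditional variances
    that add up along the choice of the pairs; adding up statistical distances
    would lose a factor [sqrt P].

    Part (1) takes [t = k = 1], [P = T] and [n ~ m]; part (2) takes [P = 1],
    [k ~ sqrt m], [t ~ T / m] and [n ~ m^(3/2) / T]. *)

Set Implicit Arguments.
Unset Strict Implicit.
Unset Printing Implicit Defensive.

Import Order.TTheory GRing.Theory Num.Theory.
Local Open Scope ring_scope.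

(** * Moments of Rademacher sums *)

Section Mean.
Variable R : realType.
Implicit Types T : finType.

Definition mean T (F : T -> R) : R := #|T|%:R^-1 * \sum_t F t.

Lemma eq_mean T (F G : T -> R) : F =1 G -> mean F = mean G.
Proof. by move=> FG; rewrite /mean (eq_bigr _ (fun t _ => FG t)). Qed.

Lemma ler_mean T (F G : T -> R) : (forall t, F t <= G t) -> mean F <= mean G.
Proof.
by move=> FG; rewrite /mean ler_wpM2l ?invr_ge0 ?ler0n // ler_sum.
Qed.

Lemma meanD T (F G : T -> R) : mean (fun t => F t + G t) = mean F + mean G.
Proof. by rewrite /mean big_split mulrDr. Qed.

Lemma meanZ T (c : R) (F : T -> R) : mean (fun t => c * F t) = c * mean F.
Proof. by rewrite /mean -mulr_sumr mulrCA. Qed.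

Lemma meanZr T (c : R) (F : T -> R) : mean (fun t => F t * c) = mean F * c.
Proof. by rewrite mulrC -meanZ; apply: eq_mean => t; rewrite mulrC. Qed.

Lemma mean_sum T (I : finType) (A : pred I) (F : I -> T -> R) :
  mean (fun t => \sum_(i | A i) F i t) = \sum_(i | A i) mean (F i).
Proof. by rewrite /mean exchange_big mulr_sumr. Qed.

Lemma mean_ge0 T (F : T -> R) : (forall t, 0 <= F t) -> 0 <= mean F.
Proof. by move=> F0; rewrite /mean mulr_ge0 ?invr_ge0 ?ler0n ?sumr_ge0. Qed.

Lemma mean_cst T (c : R) : (0 < #|T|)%N -> mean (fun _ : T => c) = c.
Proof.
move=> T0; rewrite /mean sumr_const -[c *+ _]mulr_natl mulrA mulVf ?mul1r //.
by rewrite pnatr_eq0 -lt0n.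
Qed.

Lemma mean_reindex T (f : T -> T) (F : T -> R) :
  injective f -> mean (fun t => F (f t)) = mean F.
Proof. by move=> fI; rewrite /mean [in RHS](reindex_inj fI). Qed.

Lemma mean_pair (T1 T2 : finType) (F : T1 * T2 -> R) :
  mean F = mean (fun x => mean (fun y => F (x, y))).
Proof.
rewrite /mean card_prod natrM invfM -mulrA; congr (_ * _).
rewrite -mulr_sumr; congr (_ * _).
by rewrite pair_bigA /=; apply: eq_bigr => -[].
Qed.

Definition sgn (b : bool) : R := (-1) ^+ b.

Lemma sgn_addb b c : sgn (b (+) c) = sgn b * sgn c.
Proof. by rewrite /sgn signr_addb. Qed.

Lemma sgn2 b : sgn b ^+ 2 = 1.
Proof. by rewrite /sgn sqrr_sign. Qed.

Definition flip {A : finType} (a : A) (x : {ffun A -> bool}) :=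
  [ffun i => x i (+) (i == a)].

Lemma flipK {A : finType} (a : A) : involutive (flip a).
Proof. by move=> x; apply/ffunP => i; rewrite !ffunE addbK. Qed.

Lemma sgn_flip {A : finType} (a : A) x : sgn (flip a x a) = - sgn (x a).
Proof. by rewrite ffunE eqxx sgn_addb /sgn expr1 mulrN1. Qed.

Lemma flip_neq {A : finType} (a i : A) x : i != a -> flip a x i = x i.
Proof. by move=> /negbTE ia; rewrite ffunE ia addbF. Qed.

Lemma card_cube (A : finType) : (0 < #|{ffun A -> bool}|)%N.
Proof. by apply/card_gt0P; exists [ffun=> false]. Qed.

(* The second bound only serves the induction on [l]. *)
Lemma two_point (S b t : R) (k l : nat) : 0 <= S -> 0 <= b -> t ^+ 2 <= S * b ->
  (l <= k)%N ->
  (S + b + 2 * t) ^+ l + (S + b - 2 * t) ^+ l <= 2 * (S + 4 * k%:R * b) ^+ l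
  /\ (S + 4 * k%:R * b) *
     (t * ((S + b + 2 * t) ^+ l - (S + b - 2 * t) ^+ l)) <=
     4 * l%:R * (S * b) * (S + 4 * k%:R * b) ^+ l.
Proof.
move=> S0 b0 tSb; elim: l => [|l IH] lk; first by rewrite !expr0; split; lra.
have [IHp IHq] := IH (ltnW lk).
set B := S + 4 * k%:R * b in IHp IHq *.
set p := (S + b + 2 * t) ^+ l in IHp IHq *.
set p' := (S + b - 2 * t) ^+ l in IHp IHq *.
have lk' : l%:R + 1 <= k%:R :> R by rewrite natr1 ler_nat.
have l0 : 0 <= l%:R :> R by [].
have Bn : 0 <= B ^+ l by rewrite exprn_ge0 // /B; nra.
have B0 : 0 <= B by rewrite /B; nra.
(* AM-GM: the absolute value of [2 * u] is at most [2 * sqrt (S * b)], hence at most [S + b]. *)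
have pos u : u ^+ 2 <= S * b -> 0 <= S + b + 2 * u.
  move=> uSb; rewrite leNgt; apply/negP => h.
  have h1 : 0 < (- (S + b + 2 * u)) * (S + b - 2 * u) by rewrite mulr_gt0; lra.
  have := sqr_ge0 (S - b); nra.
have pp : p + p' >= 0.
  by rewrite addr_ge0 // exprn_ge0 // ?pos // -mulrN pos // sqrrN.
(* This closes the induction for the first bound; it rests on [l + 1 <= k], which leaves room for
   [4 * l * b] in [B - S - b]. *)
have key : 4 * l%:R * S * b + (S + b) * B <= B ^+ 2.
  have hb : 4 * l%:R * b <= B - S - b by rewrite /B; nra.
  have SB : S <= B by rewrite /B; nra.
  have : S * (4 * l%:R * b) <= B * (B - S - b) by rewrite ler_pM ?mulr_ge0.
  by lra.
rewrite !exprS -natr1 -/p -/p'; split.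
  have [B00|B1] := eqVneq B 0.
    have [S00 b00] : S = 0 /\ b = 0 by rewrite /B in B00; split; nra.
    have -> : t = 0 by apply/eqP; rewrite -sqrf_eq0 eq_le sqr_ge0; nra.
    by rewrite /B S00 b00; nra.
  have B2 : 0 < B by rewrite lt_def B1.
  rewrite -(ler_pM2l B2).
  have -> : B * ((S + b + 2 * t) * p + (S + b - 2 * t) * p') =
    (S + b) * B * (p + p') + 2 * (B * (t * (p - p'))) by ring.
  have h1 : (S + b) * B * (p + p') <= (S + b) * B * (2 * B ^+ l).
    by rewrite ler_wpM2l // mulr_ge0 // addr_ge0.
  have h2 := ler_wpM2r Bn key.
  by lra.
have -> : B * (t * ((S + b + 2 * t) * p - (S + b - 2 * t) * p')) =
  (S + b) * (B * (t * (p - p'))) + 2 * B * t ^+ 2 * (p + p') by ring.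
have AB : S + b <= B by rewrite /B; nra.
have h1 : (S + b) * (B * (t * (p - p'))) <= 4 * l%:R * (S * b) * (B * B ^+ l).
  apply: (le_trans (ler_wpM2l _ IHq)); first by lra.
  have : 0 <= l%:R * (S * b) * B ^+ l by rewrite !mulr_ge0.
  nra.
have h2 : 2 * B * t ^+ 2 * (p + p') <= 2 * B * (S * b) * (2 * B ^+ l).
  apply: (ler_pM _ pp _ IHp); first by rewrite mulr_ge0 ?sqr_ge0 // mulr_ge0.
  by rewrite ler_wpM2l // mulr_ge0.
by lra.
Qed.

End Mean.

Section Khintchine.
Variable R : realType.
Local Notation sgn := (@sgn R).

Lemma cauchy_schwarz_sum (B : finType) (u v : B -> R) :
  (\sum_b u b * v b) ^+ 2 <= (\sum_b u b ^+ 2) * (\sum_b v b ^+ 2).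
Proof.
have H (a : R) : 0 <= a ^+ 2 * (\sum_b u b ^+ 2) - 2 * a * (\sum_b u b * v b)
    + \sum_b v b ^+ 2.
  rewrite mulr_sumr mulr_sumr -sumrB -big_split /= sumr_ge0 // => b _.
  by rewrite (_ : _ + _ = (a * u b - v b) ^+ 2) ?sqr_ge0 //; ring.
set U := \sum_b u b ^+ 2 in H *; set W := \sum_b u b * v b in H *.
have U0 : 0 <= U by rewrite sumr_ge0 // => b _; exact: sqr_ge0.
have V0 := H 0.
have [U00|U1] := eqVneq U 0.
  have [->|W0] := eqVneq W 0; first by rewrite U00 expr0n mul0r.
  (* With [U = 0] the quadratic is affine in [a], and this [a] gives it the value -1. *)
  have := H ((\sum_b v b ^+ 2 + 1) / (2 * W)).
  rewrite U00 mulr0 sub0r (_ : 2 * _ * W = \sum_b v b ^+ 2 + 1); last by field.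
  by lra.
have {}U0 : 0 < U by rewrite lt_def U1.
move: (mulr_ge0 (ltW U0) (H (W / U))); move: (\sum_b v b ^+ 2) => V.
have -> : U * ((W / U) ^+ 2 * U - 2 * (W / U) * W + V) = U * V - W ^+ 2.
  by field.
by rewrite subr_ge0.
Qed.

(** The coefficients are vectors indexed by [B]. Signs are removed one at a time: by [two_point],
    averaging over the sign of [a] costs no more than adding [4 * k * \sum_b c a b ^+ 2] to the
    constant. The offset [D] carries these additions through the induction. *)
Lemma khintchine (A B : finType) (c : A -> B -> R) (k : nat) (s : seq A) :
  uniq s -> forall D : R, 0 <= D ->
  mean (fun x : {ffun A -> bool} =>
    (\sum_b (\sum_(a <- s) sgn (x a) * c a b) ^+ 2 + D) ^+ k) <=
  (D + 4 * k%:R * \sum_(a <- s) \sum_b c a b ^+ 2) ^+ k.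
Proof.
elim: s => [_ D D0|a s IH /= /andP[as_ us] D D0].
  under eq_mean => x.
    under eq_bigr => b _ do rewrite big_nil expr0n /=.
    rewrite big1 // add0r; over.
  by rewrite mean_cst ?card_cube // big_nil mulr0 addr0.
pose S (x : {ffun A -> bool}) b := \sum_(a <- s) sgn (x a) * c a b.
pose N := \sum_b c a b ^+ 2.
pose F (x : {ffun A -> bool}) := (\sum_b (sgn (x a) * c a b + S x b) ^+ 2 + D) ^+ k.
have N0 : 0 <= N by rewrite sumr_ge0 // => b _; exact: sqr_ge0.
have -> : mean (fun x : {ffun A -> bool} =>
    (\sum_b (\sum_(a0 <- a :: s) sgn (x a0) * c a0 b) ^+ 2 + D) ^+ k)
  = mean F.
  by apply: eq_mean => x; rewrite /F; congr ((_ + _) ^+ _); apply: eq_bigr => b _;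
     rewrite big_cons.
have S_flip x b : S (flip a x) b = S x b.
  apply: eq_big_seq => i si; rewrite flip_neq //.
  by apply: contraNneq as_ => <-.
have meanF : 2 * mean F = mean (fun x => F x + F (flip a x)).
  by rewrite meanD (mean_reindex _ (inv_inj (flipK a))) mulr2n mulrDl mul1r.
rewrite -(ler_pM2l (ltr0n R 2)) meanF.
rewrite big_cons -/N mulrDr addrA.
have D'0 : 0 <= D + 4 * k%:R * N by rewrite addr_ge0 // !mulr_ge0.
apply: le_trans (ler_wpM2l _ (IH us _ D'0)) => //.
rewrite -meanZ; apply: ler_mean => x.
pose t := sgn (x a) * \sum_b c a b * S x b.
pose M := \sum_b S x b ^+ 2 + D.
have M0 : 0 <= M by rewrite addr_ge0 // sumr_ge0 // => b _; exact: sqr_ge0.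
have E (e : R) : e ^+ 2 = 1 ->
    \sum_b (e * c a b + S x b) ^+ 2 + D = M + N + 2 * (e * \sum_b c a b * S x b).
  move=> e1.
  rewrite (eq_bigr (fun b => S x b ^+ 2 + c a b ^+ 2 + 2 * (e * (c a b * S x b)))).
    by rewrite !big_split /= -!mulr_sumr /M /N; ring.
  by move=> b _; rewrite sqrrD exprMn e1; ring.
have tMN : t ^+ 2 <= M * N.
  rewrite /t exprMn sgn2 mul1r; apply: (@le_trans _ _ ((\sum_b S x b ^+ 2) * N)).
    by rewrite mulrC; exact: cauchy_schwarz_sum.
  by rewrite ler_wpM2r // /M lerDl.
have FE : F x = (M + N + 2 * t) ^+ k by rewrite /F E ?sgn2.
have FE' : F (flip a x) = (M + N - 2 * t) ^+ k.
  rewrite /F sgn_flip; under eq_bigr => b _ do rewrite S_flip.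
  by rewrite E ?sqrrN ?sgn2 // mulNr mulrN.
rewrite FE FE'; have [+ _] := two_point M0 N0 tMN (leqnn k).
by move=> /le_trans; apply; rewrite /M -addrA.
Qed.

End Khintchine.

(** * Level-two inequality for bilinear characters *)

Section LevelTwo.
Variable R : realType.
Local Notation sgn := (@sgn R).

Definition chi (A B : finType) (a : A) (b : B)
    (z : {ffun A -> bool} * {ffun B -> bool}) : R := sgn (z.1 a) * sgn (z.2 b).

Definition chaos (A B : finType) (c : A -> B -> R)
    (z : {ffun A -> bool} * {ffun B -> bool}) : R :=
  \sum_a \sum_b c a b * chi a b z.

(** Khintchine twice: for fixed [x] the chaos is a scalar Rademacher sum in [y], and the squares of
    its coefficients add up to the squared norm of a vector-valued Rademacher sum in [x]. Each use
    contributes a factor [4 * k]. *)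
Lemma chaos_moment (A B : finType) (c : A -> B -> R) (k : nat) :
  mean (fun z => (chaos c z ^+ 2) ^+ k) <=
  (16 * k%:R ^+ 2 * \sum_a \sum_b c a b ^+ 2) ^+ k.
Proof.
pose u (x : {ffun A -> bool}) b := \sum_a sgn (x a) * c a b.
have chaosE x y : chaos c (x, y) = \sum_b sgn (y b) * u x b.
  rewrite /chaos exchange_big; apply: eq_bigr => b _.
  by rewrite mulr_sumr; apply: eq_bigr => a _; rewrite /chi /=; ring.
rewrite mean_pair.
apply: (@le_trans _ _ (mean (fun x : {ffun A -> bool} => (4 * k%:R) ^+ k *
    (\sum_b (\sum_a sgn (x a) * c a b) ^+ 2 + 0) ^+ k))).
  apply: ler_mean => x; rewrite -exprMn.
  (* The one-element index type turns the vector inequality into the scalar one. *)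
  have := @khintchine R B 'I_1 (fun b _ => u x b) k _ (index_enum_uniq B) 0 (lexx 0).
  rewrite add0r addr0; under [in X in _ <= X -> _]eq_bigr => b _ do rewrite big_ord1.
  apply: le_trans; apply: ler_mean => y.
  by rewrite big_ord1 addr0 chaosE.
rewrite meanZ.
have := khintchine c k (index_enum_uniq A) (lexx 0).
rewrite add0r => /(ler_wpM2l _) /le_trans; apply; first by rewrite exprn_ge0 ?mulr_ge0.
by rewrite -exprMn le_eqVlt; apply/orP; left; apply/eqP; congr (_ ^+ _); ring.
Qed.

(** [h] is tested against the bilinear form whose coefficients are its own correlations on the rows
    in [S]; the pairing is then the sum [W] of squares to be bounded. The domination hypothesis
    stands in for [h <= 1], so that [h] may contain a Bayes factor larger than 1. *)
Lemma level_two (A B : finType) (h : {ffun A -> bool} * {ffun B -> bool} -> R)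
    (S : pred A) (k : nat) : (0 < k)%N -> (forall z, 0 <= h z) ->
  (forall c : A -> B -> R, (forall a b, ~~ S a -> c a b = 0) ->
     mean (fun z => h z * (chaos c z ^+ 2) ^+ k) <=
     mean (fun z => (chaos c z ^+ 2) ^+ k)) ->
  \sum_(a | S a) \sum_b mean (fun z => h z * chi a b z) ^+ 2 <=
  32 * k%:R ^+ 2 * (mean h + 2 ^- k) ^+ 2.
Proof.
move=> k0 h0 hdom.
pose c a b := if S a then mean (fun z => h z * chi a b z) else 0.
pose W := \sum_a \sum_b c a b ^+ 2.
have -> : \sum_(a | S a) \sum_b mean (fun z => h z * chi a b z) ^+ 2 = W.
  rewrite big_mkcond; apply: eq_bigr => a _; rewrite /c.
  by case: (S a) => //; rewrite big1 // => b _; rewrite expr0n.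
have WE : W = mean (fun z => h z * chaos c z).
  rewrite /W; under [RHS]eq_mean => z.
    rewrite /chaos mulr_sumr; under eq_bigr => a _ do rewrite mulr_sumr.
    over.
  rewrite mean_sum; apply: eq_bigr => a _; rewrite mean_sum; apply: eq_bigr => b _.
  under [RHS]eq_mean => z do rewrite mulrCA.
  rewrite meanZ /c; case: (S a); [by rewrite expr2 | by rewrite expr2 !mul0r].
have W0 : 0 <= W.
  by rewrite sumr_ge0 // => a _; rewrite sumr_ge0 // => b _; exact: sqr_ge0.
have k0R : 0 < k%:R :> R by rewrite ltr0n.
have [->|W1] := eqVneq W 0; first by rewrite mulr_ge0 ?sqr_ge0 // mulr_ge0 ?sqr_ge0.
have {}W0 : 0 < W by rewrite lt_def W1.
have s0 : 0 < 32 * k%:R ^+ 2 * W by rewrite !mulr_gt0 ?exprn_gt0.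
pose q := Num.sqrt (32 * k%:R ^+ 2 * W).
have q0 : 0 < q by rewrite sqrtr_gt0.
have q2 : q ^+ 2 = 32 * k%:R ^+ 2 * W by rewrite sqr_sqrtr // ltW.
(* Truncation at the level [q] that balances the two terms in [WW]. *)
have pw Q : Q <= q + q * (q ^- 2) ^+ k * (Q ^+ 2) ^+ k.
  rewrite -mulrA -exprMn; have [Qq|qQ] := leP Q q.
    by apply: (le_trans Qq); rewrite lerDl (mulr_ge0 (ltW q0)) // exprn_ge0 //
      mulr_ge0 ?sqr_ge0 // invr_ge0 sqr_ge0.
  have Q0 : 0 < Q by apply: lt_trans qQ.
  have y1 : Q / q <= q ^- 2 * Q ^+ 2.
    rewrite -exprVn -exprMn mulrC expr2 ler_peMl ?ltW ?mulr_gt0 ?invr_gt0 //.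
    by rewrite ltr_pdivlMl ?mulr1.
  have y2 : 1 <= q ^- 2 * Q ^+ 2.
    by apply: le_trans y1; rewrite ler_pdivlMr ?mul1r // ltW.
  have := le_trans y1 (ler_eXnr k0 y2); rewrite ler_pdivrMr // mulrC => /le_trans -> //.
  by rewrite lerDr ltW.
have WW : W <= q * (mean h + 2 ^- k).
  rewrite {1}WE; apply: (@le_trans _ _ (mean (fun z => q * h z +
      q * (q ^- 2) ^+ k * (h z * (chaos c z ^+ 2) ^+ k)))).
    apply: ler_mean => z; apply: (le_trans (ler_wpM2l (h0 z) (pw _))).
    by rewrite le_eqVlt; apply/orP; left; apply/eqP; ring.
  rewrite meanD !meanZ mulrDr lerD2l -mulrA ler_pM2l //.
  have cS a b : ~~ S a -> c a b = 0 by rewrite /c => /negbTE ->.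
  apply: (@le_trans _ _ ((q ^- 2) ^+ k * (16 * k%:R ^+ 2 * W) ^+ k)).
    rewrite ler_wpM2l ?exprn_ge0 ?invr_ge0 ?sqr_ge0 //.
    by apply: (le_trans (hdom _ cS)); exact: chaos_moment.
  (* [q ^+ 2] is twice the base [16 * k ^ 2 * W] of the moment bound, whence [2 ^- k]. *)
  rewrite -exprMn -exprVn q2 le_eqVlt; apply/orP; left; apply/eqP; congr (_ ^+ _).
  by field; rewrite W1 gt_eqF.
have h2 : 0 <= mean h + 2 ^- k by rewrite addr_ge0 ?mean_ge0 // invr_ge0 exprn_ge0.
have : W * W <= q ^+ 2 * (mean h + 2 ^- k) ^+ 2.
  by rewrite -exprMn -expr2 ler_pXn2r ?nnegrE ?mulr_ge0 // ltW.
rewrite q2 => WWq; rewrite -(ler_pM2l W0); apply: (le_trans WWq).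
by rewrite le_eqVlt; apply/orP; left; apply/eqP; ring.
Qed.

End LevelTwo.

(** * Conditioning on parities *)

Section Densities.
Variable R : realType.
Local Notation sgn := (@sgn R).

Local Notation chi := (@chi R _ _).

Lemma mean_odd (T : finType) (g : T -> T) (F : T -> R) :
  injective g -> (forall t, F (g t) = - F t) -> mean F = 0.
Proof.
move=> gI Fg; have := mean_reindex F gI; rewrite (eq_mean Fg) => E.
have : mean F + mean F = 0.
  by rewrite -{1}E -meanD /mean big1 ?mulr0 // => t _; rewrite addNr.
by lra.
Qed.

Section Density.
Variables (A B : finType) (P : nat).
Local Notation cube := ({ffun A -> bool} * {ffun B -> bool})%type.
Implicit Types (a : 'I_P -> A) (b : 'I_P -> B) (v : {ffun 'I_P -> bool}).
Implicit Types (f : cube -> R) (z : cube).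

Lemma factorE (u : bool) (a : A) (b : B) z :
  1 + sgn u * chi a b z = 2 * (u == z.1 a (+) z.2 b)%:R.
Proof.
rewrite /chi -!sgn_addb /sgn.
by case: u; case: (z.1 a); case: (z.2 b); rewrite /= ?expr0 ?expr1; lra.
Qed.

(* Bayes factor of the parities [v i] of the first [j] pairs: averaging over the
   cube against it is conditioning on them, up to the factor [2 ^ j]. *)
Definition dens a b v (j : nat) z : R :=
  \prod_(i < P | (i < j)%N) (1 + sgn (v i) * chi (a i) (b i) z).

Definition upd (T : Type) (g : 'I_P -> T) (i0 : 'I_P) (t : T) i :=
  if i == i0 then t else g i.

Lemma dens_ge0 a b v j z : 0 <= dens a b v j z.
Proof. by apply: prodr_ge0 => i _; rewrite factorE mulr_ge0. Qed.

Lemma eq_dens a a' b b' v v' j :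
  (forall i : 'I_P, (i < j)%N -> [/\ a i = a' i, b i = b' i & v i = v' i]) ->
  dens a b v j =1 dens a' b' v' j.
Proof.
by move=> E z; apply: eq_bigr => i ij; have [-> -> ->] := E i ij.
Qed.

Lemma dens_recr a b v z (j : 'I_P) :
  dens a b v j.+1 z = dens a b v j z * (1 + sgn (v j) * chi (a j) (b j) z).
Proof.
rewrite /dens (bigD1 j) //= mulrC; congr (_ * _); apply: eq_bigl => i.
by rewrite ltnS ltn_neqAle andbC.
Qed.

Definition flip1 (a : A) z : cube := (flip a z.1, z.2).

Lemma flip1_inj (a : A) : injective (flip1 a).
Proof.
by move=> [x y] [x' y'] [/(inv_inj (flipK a)) -> ->].
Qed.

Lemma chi_flip1 (a : A) (b : B) z : chi a b (flip1 a z) = - chi a b z.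
Proof. by rewrite /chi /= sgn_flip mulNr. Qed.

Lemma chi_flip1_neq (a a' : A) (b : B) z : a' != a -> chi a' b (flip1 a z) = chi a' b z.
Proof. by move=> h; rewrite /chi /= flip_neq. Qed.

(** The last character is odd under the flip of its left coordinate, which changes neither [Q] nor
    the earlier factors, the left vertices being distinct. So only the constant term of each factor
    survives. *)
Lemma mean_dens a b v j (Q : cube -> R) : (j <= P)%N ->
  {in [pred i : 'I_P | (i < j)%N] &, injective a} ->
  (forall i : 'I_P, (i < j)%N -> forall z, Q (flip1 (a i) z) = Q z) ->
  mean (fun z => dens a b v j z * Q z) = mean Q.
Proof.
elim: j => [_ _ _|j IH jP aI Qa].
  by apply: eq_mean => z; rewrite /dens big1 ?mul1r.
pose j' := Ordinal jP.
under eq_mean => z.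
  rewrite (dens_recr a b v z j') mulrDr mulr1 mulrDl.
  over.
rewrite meanD {1}IH ?(ltnW jP) //; last first.
- by move=> i ij; apply: Qa; exact: ltnW.
- by move=> i i' ij ij'; apply: aI; rewrite inE ltnW.
rewrite [X in _ + X](mean_odd (@flip1_inj (a j'))) ?addr0 // => z.
rewrite (Qa j') // chi_flip1 mulrN mulrN mulNr; congr (- (_ * _ * _)).
apply: eq_bigr => i ij; rewrite chi_flip1_neq //.
apply/eqP => aij; have E : i = j' by apply: aI => //; rewrite inE ltnS ?(ltnW ij) /=.
by move: ij; rewrite E ltnn.
Qed.

(** When the first [j] left vertices are distinct, this is the conditional mean of [f] given that
    the first [j] parities are those of [v]. *)
Definition pr f a b v j : R := mean (fun z => f z * dens a b v j z).

(** A variance over uniform [v]: the average of [pr] over [v] is [mean f]. *)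
Definition vari f a b j : R := mean (fun v => (pr f a b v j - mean f) ^+ 2).

(** Up to sign, the change of [pr] when [(a0, b0)] becomes the next pair. *)
Definition coef f a b v j (a0 : A) (b0 : B) : R :=
  mean (fun z => f z * dens a b v j z * chi a0 b0 z).

Lemma vari_ge0 f a b j : 0 <= vari f a b j.
Proof. by apply: mean_ge0 => v; exact: sqr_ge0. Qed.

Lemma vari0 f a b : vari f a b 0 = 0.
Proof.
rewrite /vari /mean big1 ?mulr0 // => v _; apply/eqP; rewrite sqrf_eq0 subr_eq0.
by apply/eqP/eq_mean => z; rewrite /dens big1 ?mulr1.
Qed.

(** Orthogonality of martingale increments: the new pair changes [pr] by [coef] times a sign that
    depends on [v j] alone, so the cross term cancels when [v j] is flipped. *)
Lemma vari_upd f a b (j : 'I_P) (a0 : A) (b0 : B) :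
  vari f (upd a j a0) (upd b j b0) j.+1 =
  vari f a b j + mean (fun v => coef f a b v j a0 b0 ^+ 2).
Proof.
have prE v : pr f (upd a j a0) (upd b j b0) v j.+1 =
    pr f a b v j + sgn (v j) * coef f a b v j a0 b0.
  rewrite /pr /coef -meanZ -meanD; apply: eq_mean => z.
  rewrite dens_recr /upd !eqxx.
  rewrite (@eq_dens _ a _ b _ v); first by ring.
  move=> i ij; have /negbTE -> // : i != j.
  by rewrite -(inj_eq val_inj) /= neq_ltn ij.
rewrite /vari.
have -> : mean (fun v => (pr f (upd a j a0) (upd b j b0) v j.+1 - mean f) ^+ 2) =
    mean (fun v => (pr f a b v j - mean f) ^+ 2 + coef f a b v j a0 b0 ^+ 2 +
      2 * sgn (v j) * ((pr f a b v j - mean f) * coef f a b v j a0 b0)).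
  apply: eq_mean => v; rewrite prE.
  transitivity ((pr f a b v j - mean f) ^+ 2 + sgn (v j) ^+ 2 * coef f a b v j a0 b0 ^+ 2 +
      2 * sgn (v j) * ((pr f a b v j - mean f) * coef f a b v j a0 b0)); first by ring.
  by rewrite sgn2 mul1r.
rewrite !meanD -[RHS]addr0; congr (_ + _).
apply: (mean_odd (inv_inj (flipK j))) => v.
have D z : dens a b (flip j v) j z = dens a b v j z.
  by apply: eq_dens => i ij; rewrite flip_neq // -(inj_eq val_inj) /= neq_ltn ij.
rewrite sgn_flip mulrN mulNr; congr (- (_ * (_ * _))).
  by congr (_ - _); apply: eq_mean => z; rewrite D.
by apply: eq_mean => z; rewrite D.
Qed.

Definition fresh (T : finType) (g : 'I_P -> T) (j : nat) : {set T} :=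
  ~: [set g i | i in [set i : 'I_P | (i < j)%N]].

Lemma freshP (T : finType) (g : 'I_P -> T) (j : nat) t :
  t \in fresh g j -> forall i : 'I_P, (i < j)%N -> g i != t.
Proof.
rewrite inE => h i ij; apply: contraNneq h => <-.
by apply: imset_f; rewrite inE.
Qed.

Lemma card_fresh (T : finType) (g : 'I_P -> T) (j : nat) :
  (j <= P)%N -> (#|T| - j <= #|fresh g j|)%N.
Proof.
move=> jP; rewrite cardsCs setCK leq_sub2l // (leq_trans (leq_imset_card _ _)) //.
rewrite -sum1_card; under eq_bigl => i do rewrite inE.
by rewrite -(big_ord_widen P (fun=> 1%N) jP) sum1_card card_ord.
Qed.

Lemma upd_inj (T : finType) (g : 'I_P -> T) (j : 'I_P) t :
  t \in fresh g j -> {in [pred i : 'I_P | (i < j)%N] &, injective g} ->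
  {in [pred i : 'I_P | (i < j.+1)%N] &, injective (upd g j t)}.
Proof.
move=> /freshP tf gI i i'; rewrite !inE !ltnS /upd => ij ij'.
case: eqVneq => [->|ne]; case: eqVneq => [-> //|ne'] E.
- by have := tf i'; rewrite ltn_neqAle ne' ij' -E eqxx => /(_ isT).
- by have := tf i; rewrite ltn_neqAle ne ij E eqxx => /(_ isT).
- by apply: gI => //; rewrite inE ltn_neqAle ?ne ?ne'.
Qed.

(** [level_two] for [f] times the Bayes factor. Domination holds because [f <= 1] and because a
    chaos on fresh rows ignores the coordinates [a i] already used, so that [mean_dens] averages the
    Bayes factor out. *)
Lemma sum_coef f a b v j (k : nat) : (0 < k)%N -> (j <= P)%N ->
  (forall z, 0 <= f z <= 1) ->
  {in [pred i : 'I_P | (i < j)%N] &, injective a} ->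
  \sum_(a0 in fresh a j) \sum_b0 coef f a b v j a0 b0 ^+ 2 <=
  32 * k%:R ^+ 2 * (pr f a b v j + 2 ^- k) ^+ 2.
Proof.
move=> k0 jP f01 aI.
refine (@level_two R A B (fun z => f z * dens a b v j z) (mem (fresh a j)) k k0 _ _).
  by move=> z; have /andP[? _] := f01 z; rewrite mulr_ge0 ?dens_ge0.
move=> c cS.
rewrite -[leRHS](mean_dens b v jP aI); last first.
  move=> i ij z; congr ((_ ^+ _) ^+ _); rewrite /chaos; apply: eq_bigr => a0 _.
  have [a0f|a0f] := boolP (a0 \in fresh a j).
    by apply: eq_bigr => b0 _; rewrite chi_flip1_neq // eq_sym (freshP a0f).
  by rewrite !big1 // => b0 _; rewrite cS // mul0r.
apply: ler_mean => z; have /andP[_ f1] := f01 z.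
apply: ler_wpM2r; first by rewrite exprn_ge0 ?sqr_ge0.
by apply: ler_piMl => //; exact: dens_ge0.
Qed.

End Density.
End Densities.

(** * Greedy choice of the pairs *)

Section GreedyChoice.
Variable R : realType.

Lemma exists_le_average (T : finType) (U : {set T}) (F : T -> R) (c : R) :
  (0 < #|U|)%N -> \sum_(u in U) F u <= #|U|%:R * c ->
  exists2 u, u \in U & F u <= c.
Proof.
move=> U0 h; have [/existsP[u /andP[uU Fu]]|/existsPn nex] :=
  boolP [exists u, (u \in U) && (F u <= c)]; first by exists u.
suff : #|U|%:R * c < \sum_(u in U) F u by rewrite ltNge h.
rewrite mulr_natl -sumr_const; apply: ltr_sum.
  by have /card_gt0P[u uU] := U0; apply/hasP; exists u; rewrite ?mem_index_enum.
by move=> u uU; have := nex u; rewrite uU /= ltNge.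
Qed.

Section Greedy.
Variables (A B : finType) (n P k : nat).
Hypotheses (cardA : #|A| = n) (cardB : #|B| = n) (k0 : (0 < k)%N).
Hypotheses (n0 : (0 < n)%N) (Pn : (2 * P <= n)%N).
Local Notation cube := ({ffun A -> bool} * {ffun B -> bool})%type.
Variables (I : finType) (w : I -> R) (f : I -> cube -> R).
Hypotheses (w0 : forall i, 0 <= w i) (f01 : forall i z, 0 <= f i z <= 1).

(* The summand [2 ^- k] keeps the moment bound usable for improbable messages;
   over all the [2 ^ s] messages it adds a bounded total when [s < k]. *)
Definition smoothed (i : I) : R := mean (f i) + 2 ^- k.

Lemma smoothed_gt0 i : 0 < smoothed i.
Proof.
rewrite ltr_wpDl ?invr_gt0 ?exprn_gt0 // mean_ge0 // => z.
by have /andP[] := f01 i z.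
Qed.

(** The second term, constant in [j], makes the growth multiplicative: the expected increase at each
    step is bounded by a multiple of the potential itself. *)
Definition potential (a : 'I_P -> A) (b : 'I_P -> B) (j : nat) : R :=
  \sum_i w i * (vari (f i) a b j / smoothed i + smoothed i).

(** One matching must serve all the [f i] at once, so the next pair is chosen by averaging the
    potential over all fresh pairs. *)
Lemma greedy (j : nat) : (j <= P)%N ->
  exists (a : 'I_P -> A) (b : 'I_P -> B),
  [/\ {in [pred i : 'I_P | (i < j)%N] &, injective a},
      {in [pred i : 'I_P | (i < j)%N] &, injective b} &
      potential a b j <= (1 + 256 * k%:R ^+ 2 / n%:R ^+ 2) ^+ j *
                         \sum_i w i * smoothed i].
Proof.
elim: j => [_|j IH jP].
  have /card_gt0P[a0 _] : (0 < #|A|)%N by rewrite cardA.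
  have /card_gt0P[b0 _] : (0 < #|B|)%N by rewrite cardB.
  exists (fun=> a0), (fun=> b0); split=> [i i'|i i'|]; rewrite ?inE //.
  rewrite expr0 mul1r /potential le_eqVlt; apply/orP; left; apply/eqP.
  by apply: eq_bigr => i _; rewrite vari0 mul0r add0r.
have [a [b [aI bI IHj]]] := IH (ltnW jP).
pose j' := Ordinal jP.
pose U := setX (fresh a j) (fresh b j).
(* Since [2 * P <= n], at least half of the vertices on each side are fresh. *)
have cardU : (n ^ 2 <= 4 * #|U|)%N.
  rewrite cardsX; have := card_fresh a (ltnW jP); have := card_fresh b (ltnW jP).
  by rewrite cardA cardB; move: #|fresh a j| #|fresh b j| => u1 u2; nia.
have U0 : (0 < #|U|)%N by move: n0 cardU; rewrite -mulnn; nia.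
have n0R : 0 < n%:R :> R by rewrite ltr0n.
have U0R : 0 < #|U|%:R :> R by rewrite ltr0n.
pose g : R := 256 * k%:R ^+ 2 / n%:R ^+ 2.
have Psi0 : 0 <= potential a b j.
  apply: sumr_ge0 => i _; rewrite mulr_ge0 // addr_ge0 // ?(ltW (smoothed_gt0 i)) //.
  by rewrite divr_ge0 ?vari_ge0 // ltW ?smoothed_gt0.
have gU : 64 * k%:R ^+ 2 <= #|U|%:R * g.
  rewrite /g [_ * (_ / _)]mulrA ler_pdivlMr ?exprn_gt0 //.
  have : n%:R ^+ 2 <= 4 * #|U|%:R :> R by rewrite -natrX -natrM ler_nat.
  have : 0 <= k%:R ^+ 2 :> R by exact: sqr_ge0.
  by nra.
have step i : \sum_(u in U) mean (fun v => coef (f i) a b v j u.1 u.2 ^+ 2) <=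
    64 * k%:R ^+ 2 * (vari (f i) a b j + smoothed i ^+ 2).
  rewrite -mean_sum -[smoothed i ^+ 2](@mean_cst _ {ffun 'I_P -> bool}) ?card_cube //.
  rewrite -meanD -meanZ; apply: ler_mean => v.
  apply: (@le_trans _ _ (\sum_(a0 in fresh a j) \sum_b0 coef (f i) a b v j a0 b0 ^+ 2)).
    rewrite (eq_bigl (fun u => (u.1 \in fresh a j) && (u.2 \in fresh b j))); last first.
      by move=> u; rewrite inE.
    rewrite -(pair_big (mem (fresh a j)) (mem (fresh b j))
      (fun a0 b0 => coef (f i) a b v j a0 b0 ^+ 2)) /=.
    apply: ler_sum => a0 _; rewrite [leRHS](bigID (mem (fresh b j))) /= lerDl.
    by apply: sumr_ge0 => b0 _; exact: sqr_ge0.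
  apply: (le_trans (sum_coef _ _ k0 (ltnW jP) (f01 i) aI)).
  (* Splitting off the deviation from the mean, the square of the sum is at most twice the sum of
     the squares, whence 64 from 32. *)
  rewrite (_ : pr (f i) a b v j + 2 ^- k = (pr (f i) a b v j - mean (f i)) + smoothed i);
    last by rewrite /smoothed; ring.
  move: (pr _ _ _ _ _ - _) (smoothed i) => p q.
  have := sqr_ge0 (p - q); have : 0 <= k%:R ^+ 2 :> R by exact: sqr_ge0.
  by nra.
have [|u uU hu] := @exists_le_average _ U
    (fun u => potential (upd a j' u.1) (upd b j' u.2) j.+1) ((1 + g) * potential a b j) U0.
  apply: (@le_trans _ _ (\sum_(u in U) (potential a b j + \sum_i w i *
      (mean (fun v => coef (f i) a b v j u.1 u.2 ^+ 2) / smoothed i)))).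
    apply: ler_sum => u _; rewrite /potential -big_split /=; apply: ler_sum => i _.
    by rewrite (vari_upd _ _ _ j') le_eqVlt; apply/orP; left; apply/eqP; ring.
  rewrite big_split /= sumr_const -[_ *+ #|U|]mulr_natl [(1 + g) * _]mulrDl mul1r.
  rewrite [leRHS]mulrDr lerD2l [leRHS]mulrA.
  apply: le_trans (ler_wpM2r Psi0 gU).
  rewrite exchange_big /potential mulr_sumr; apply: ler_sum => i _.
  rewrite -mulr_sumr mulrCA ler_wpM2l // -mulr_suml ler_pdivrMr ?smoothed_gt0 //.
  apply: (le_trans (step i)); rewrite le_eqVlt; apply/orP; left; apply/eqP.
  by field; rewrite gt_eqF ?smoothed_gt0.
have /setXP[u1 u2] : (u.1, u.2) \in U by case: (u) uU.
exists (upd a j' u.1), (upd b j' u.2); split.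
- exact: (@upd_inj P A a j').
- exact: (@upd_inj P B b j').
apply: (le_trans hu); rewrite exprS -mulrA ler_wpM2l //.
by rewrite addr_ge0 // divr_ge0 ?mulr_ge0 ?sqr_ge0.
Qed.

End Greedy.
End GreedyChoice.

(** * The communication problem *)

Section HiddenMatching.
Variable R : realType.

Local Notation chi := (@chi R _ _).

Lemma mean_exchange (T1 T2 : finType) (F : T1 -> T2 -> R) :
  mean (fun x => mean (F x)) = mean (fun y => mean (F ^~ y)).
Proof. by rewrite /mean -!mulr_sumr mulrCA exchange_big. Qed.

Section Advantage.
Variables (A B : finType) (P : nat).
Local Notation cube := ({ffun A -> bool} * {ffun B -> bool})%type.
Implicit Types (f : cube -> R) (z : cube).

Definition parity (a : 'I_P -> A) (b : 'I_P -> B) z : {ffun 'I_P -> bool} :=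
  [ffun i => z.1 (a i) (+) z.2 (b i)].

Definition negf (v : {ffun 'I_P -> bool}) : {ffun 'I_P -> bool} :=
  [ffun i => ~~ v i].

Lemma negfK : involutive negf.
Proof. by move=> v; apply/ffunP => i; rewrite !ffunE negbK. Qed.

Lemma densE (a : 'I_P -> A) (b : 'I_P -> B) v z :
  dens R a b v P z = 2 ^+ P * (v == parity a b z)%:R.
Proof.
rewrite /dens; under eq_bigl => i do rewrite ltn_ord.
under eq_bigr => i _ do rewrite factorE.
rewrite big_split /= prodr_const card_ord; congr (_ * _).
have [->|] := eqVneq v.
  by rewrite big1 // => i _; rewrite ffunE eqxx.
move=> /eqP/ffunP/eqfunP; rewrite negb_forall => /existsP[i].
by rewrite ffunE => /negbTE E; rewrite (bigD1 i) //= E mul0r.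
Qed.

Lemma mean_parity (a : 'I_P -> A) (b : 'I_P -> B) f (D : {ffun 'I_P -> bool} -> R) :
  mean (fun z => f z * D (parity a b z)) = mean (fun v => D v * pr f a b v P).
Proof.
transitivity (mean (fun v => mean (fun z => f z * (D v * dens R a b v P z)))); last first.
  apply: eq_mean => v; rewrite /pr -meanZ; apply: eq_mean => z.
  by rewrite mulrCA.
rewrite mean_exchange; apply: eq_mean => z; rewrite meanZ; congr (_ * _).
rewrite /mean (bigD1 (parity a b z)) //= densE eqxx mulr1 big1 ?addr0.
  rewrite card_ffun card_bool card_ord natrX mulrCA mulVf ?mulr1 //.
  by rewrite expf_neq0 // pnatr_eq0.
by move=> v /negbTE vp; rewrite densE vp !mulr0.
Qed.

(** [D v - D (negf v)] averages to zero over [v], so [mean f] may be subtracted from [pr]. AM-GM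
    with a free [t] then gives a bound linear in [vari / p], which can be summed over messages. *)
Lemma advantage_le (a : 'I_P -> A) (b : 'I_P -> B) f
    (D : {ffun 'I_P -> bool} -> bool) (p t : R) : 0 < p -> 0 < t ->
  mean (fun z => f z * ((D (parity a b z))%:R - (D (negf (parity a b z)))%:R)) <=
  t * p / 2 + (2 * t)^-1 * (vari f a b P / p).
Proof.
move=> p0 t0.
pose d v : R := (D v)%:R - (D (negf v))%:R.
rewrite (mean_parity a b f d).
have d0 : mean (fun v => d v * mean f) = 0.
  rewrite meanZr /d meanD.
  rewrite -[X in _ + X](mean_reindex _ (inv_inj negfK)).
  under [X in _ + X]eq_mean => v do rewrite negfK.
  by rewrite -meanD /mean big1 ?mulr0 ?mul0r // => v _; rewrite subrr.
have -> : mean (fun v => d v * pr f a b v P) =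
    mean (fun v => d v * (pr f a b v P - mean f)).
  by rewrite -[RHS]addr0 -d0 -meanD; apply: eq_mean => v; ring.
rewrite /vari -meanZr -meanZ.
rewrite -[t * p / 2](@mean_cst _ {ffun 'I_P -> bool}) ?card_cube // -meanD.
apply: ler_mean => v; move: (pr f a b v P - mean f) => u.
have tp : 0 < 2 * t * p by rewrite !mulr_gt0.
rewrite -(ler_pM2l tp).
have -> : 2 * t * p * (t * p / 2 + (2 * t)^-1 * (u ^+ 2 / p)) = (t * p) ^+ 2 + u ^+ 2.
  by field; rewrite !gt_eqF.
rewrite /d; have := sqr_ge0 (t * p - u); have := sqr_ge0 (t * p + u).
have := sqr_ge0 u; have := sqr_ge0 (t * p).
by case: (D v); case: (D (negf v)) => /=; rewrite ?subrr ?subr0 ?sub0r; nra.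
Qed.

End Advantage.

Lemma bernoulli_upper (g : R) (P j : nat) : 0 <= g -> 2 * (g * P%:R) <= 1 ->
  (j <= P)%N -> (1 + g) ^+ j <= 1 + 2 * g * j%:R.
Proof.
move=> g0 gP; elim: j => [|j IH] jP; first by rewrite expr0 mulr0 addr0.
have jP' : j%:R <= P%:R :> R by rewrite ler_nat ltnW.
have j0 : 0 <= j%:R :> R by [].
rewrite exprS -natr1; apply: (le_trans (ler_wpM2l _ (IH (ltnW jP)))); first lra.
have : g * j%:R <= g * P%:R by rewrite ler_wpM2l.
nra.
Qed.

(** [W] is the space of shared seeds. The matching is chosen before the decision rule [D], and works
    for every [D]. *)
Lemma hidden_matching (A B W M : finType) (n P s : nat) (w : W -> R)
    (msg : W -> {ffun A -> bool} * {ffun B -> bool} -> M) :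
  #|A| = n -> #|B| = n -> (0 < n)%N -> (2 * P <= n)%N ->
  72 * 256 * s.+1%:R ^+ 2 * P%:R < n%:R ^+ 2 :> R -> #|M| = (2 ^ s)%N ->
  (forall i, 0 <= w i) -> \sum_i w i = 1 ->
  exists (a : 'I_P -> A) (b : 'I_P -> B),
  [/\ injective a, injective b &
    forall D : W -> M -> {ffun 'I_P -> bool} -> bool,
    mean (fun z => \sum_i w i * ((D i (msg i z) (parity a b z))%:R -
                                 (D i (msg i z) (negf (parity a b z)))%:R)) < 3^-1].
Proof.
move=> cardA cardB n0 Pn hs cardM w0 w1.
(* For each seed and message, the indicator of the inputs that produce this message. *)
pose f (i : W * M) z : R := (msg i.1 z == i.2)%:R.
pose w' (i : W * M) := w i.1.
have f01 i z : 0 <= f i z <= 1 by rewrite /f ler0n lern1 leq_b1.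
have [a [b [aI bI]]] :=
  greedy cardA cardB (ltn0Sn s) n0 Pn (fun i => w0 i.1) f01 (leqnn P).
set g : R := 256 * _ / _; set Sm := \sum_i _ => pot.
exists a, b; split.
- by move=> i i' E; apply: aI; rewrite ?inE.
- by move=> i i' E; apply: bI; rewrite ?inE.
move=> D; have n0R : 0 < n%:R :> R by rewrite ltr0n.
have g0 : 0 <= g by rewrite divr_ge0 ?mulr_ge0 ?sqr_ge0.
have gP : 72 * (g * P%:R) < 1.
  have -> : 72 * (g * P%:R) = (72 * 256 * s.+1%:R ^+ 2 * P%:R) / n%:R ^+ 2.
    by rewrite /g; field; rewrite gt_eqF.
  by rewrite ltr_pdivrMr ?mul1r // exprn_gt0.
(* For each seed the means add up to 1, and the [2 ^ s] smoothing terms [2 ^- (s + 1)] to 1/2. *)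
have SmE : Sm = 3 / 2.
  rewrite /Sm -(pair_bigA _ (fun i m => w i * smoothed s.+1 f (i, m))) /=.
  transitivity (\sum_i w i * (3 / 2)); last by rewrite -mulr_suml w1 mul1r.
  apply: eq_bigr => i _; rewrite -mulr_sumr; congr (_ * _).
  rewrite /smoothed big_split /= -mean_sum sumr_const.
  rewrite (_ : mean _ = 1); last first.
    under eq_mean => z.
      rewrite (bigD1 (msg i z)) //= /f /= eqxx big1 ?addr0; first over.
      by move=> m /negbTE; rewrite eq_sym => ->.
    by rewrite mean_cst // card_prod muln_gt0 !card_cube.
  rewrite cardM -[_ *+ (2 ^ s)]mulr_natl natrX exprS; field.
  by rewrite expf_neq0 // pnatr_eq0.
have potE : \sum_i w' i * (vari (f i) a b P / smoothed s.+1 f i) <= 3 * (g * P%:R).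
  have : potential s.+1 w' f a b P =
      \sum_i w' i * (vari (f i) a b P / smoothed s.+1 f i) + Sm.
    by rewrite /Sm -big_split /=; apply: eq_bigr => i _; rewrite mulrDr.
  have := @bernoulli_upper g P P g0 _ (leqnn P).
  move: pot; rewrite SmE => pot h E; rewrite E in pot.
  by have := h ltac:(lra); lra.
have smg i : 0 < smoothed s.+1 f i by apply: smoothed_gt0.
have advE : mean (fun z => \sum_i w i * ((D i (msg i z) (parity a b z))%:R -
      (D i (msg i z) (negf (parity a b z)))%:R)) =
    \sum_i w' i * mean (fun z => f i z * ((D i.1 i.2 (parity a b z))%:R -
      (D i.1 i.2 (negf (parity a b z)))%:R)).
  rewrite -[RHS](pair_bigA _ (fun i m => w i * mean (fun z => f (i, m) z *
    ((D i m (parity a b z))%:R - (D i m (negf (parity a b z)))%:R)))) /=.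
  rewrite mean_sum; apply: eq_bigr => i _; rewrite meanZ -mulr_sumr; congr (_ * _).
  rewrite -mean_sum; apply: eq_mean => z.
  rewrite (bigD1 (msg i z)) //= /f /= eqxx mul1r big1 ?addr0 // => m /negbTE.
  by rewrite eq_sym => ->; rewrite mul0r.
rewrite advE.
(* With [t = 1/6] the total is [Sm / 12 + 3 * (3 * g * P)], which is less than [1/8 + 1/8]. *)
apply: (@le_lt_trans _ _ (\sum_i w' i * (6^-1 * smoothed s.+1 f i / 2 +
    (2 * 6^-1)^-1 * (vari (f i) a b P / smoothed s.+1 f i)))).
  apply: ler_sum => i _; apply: ler_wpM2l; first exact: w0.
  by apply: advantage_le; rewrite ?invr_gt0 //; exact: smg.
have -> : \sum_i w' i * (6^-1 * smoothed s.+1 f i / 2 +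
    (2 * 6^-1)^-1 * (vari (f i) a b P / smoothed s.+1 f i)) =
  12^-1 * Sm + 3 * \sum_i w' i * (vari (f i) a b P / smoothed s.+1 f i).
  rewrite /Sm !mulr_sumr -big_split /=; apply: eq_bigr => i _.
  by rewrite /w' /=; field; rewrite gt_eqF.
by rewrite SmE; lra.
Qed.

End HiddenMatching.

(** * Tripartite graphs *)

Section Tripartite.
Variables (V C L M : finType) (phi : C + L + M -> V).
Hypothesis phi_inj : injective phi.
Variables (E1 : {set C * L}) (E2 : {set C * M}) (E3 : {set L * M}).

Definition edge1 (q : C * L) : {set V} := [set phi (inl (inl q.1)); phi (inl (inr q.2))].
Definition edge2 (q : C * M) : {set V} := [set phi (inl (inl q.1)); phi (inr q.2)].
Definition edge3 (q : L * M) : {set V} := [set phi (inl (inr q.1)); phi (inr q.2)].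

Definition stream1 := map edge1 (enum E1).
Definition stream2 := map edge2 (enum E2).
Definition stream3 := map edge3 (enum E3).
(** Bob's edges [E3] come last, so that the prefix is Alice's part of the stream. *)
Definition stream := (stream1 ++ stream2) ++ stream3.

Definition adj (u v : C + L + M) : bool :=
  match u, v with
  | inl (inl c), inl (inr l) | inl (inr l), inl (inl c) => (c, l) \in E1
  | inl (inl c), inr r | inr r, inl (inl c) => (c, r) \in E2
  | inl (inr l), inr r | inr r, inl (inr l) => (l, r) \in E3
  | _, _ => false
  end.

Lemma adj_sym : symmetric adj.
Proof. by case=> [[c|l]|r] [[c'|l']|r']. Qed.

Lemma adj_irr u : adj u u = false.
Proof. by case: u => [[c|l]|r]. Qed.

Lemma mem_stream e :
  reflect (exists u v, adj u v /\ e = [set phi u; phi v]) (e \in stream).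
Proof.
rewrite !mem_cat; apply: (iffP idP) => [/orP[/orP[]|]|].
- by case/mapP=> q; rewrite mem_enum => qE ->; exists (inl (inl q.1)), (inl (inr q.2));
    rewrite /= -surjective_pairing.
- by case/mapP=> q; rewrite mem_enum => qE ->; exists (inl (inl q.1)), (inr q.2);
    rewrite /= -surjective_pairing.
- by case/mapP=> q; rewrite mem_enum => qE ->; exists (inl (inr q.1)), (inr q.2);
    rewrite /= -surjective_pairing.
case=> u [v [uv ->]].
(* The endpoints may be listed in the order of their classes, which leaves three cases. *)
wlog : u v uv / match u, v with
  | inl (inl _), inl (inr _) | inl (inl _), inr _ | inl (inr _), inr _ => true
  | _, _ => false end.
  move=> H; have vu : adj v u by rewrite adj_sym.
  have H1 := H u v uv; have := H v u vu; rewrite [[set phi v; phi u]]setUC.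
  by case: u v uv vu H1 {H} => [[c|l]|r] [[c'|l']|r'] //= _ _ H1 H2;
    first [exact: H1 | exact: H2].
case: u v uv => [[c|l]|r] [[c'|l']|r'] //= uv _; apply/orP.
- by left; apply/orP; left; apply/mapP; exists (c, l'); rewrite ?mem_enum.
- by left; apply/orP; right; apply/mapP; exists (c, r'); rewrite ?mem_enum.
- by right; apply/mapP; exists (l, r'); rewrite ?mem_enum.
Qed.

Lemma set2_inj (T : finType) (p q p' q' : T) :
  [set p; q] = [set p'; q'] -> p != q' -> q != p' -> p = p' /\ q = q'.
Proof.
move=> E pq qp; have /set2P[->|/eqP] : p \in [set p'; q'] by rewrite -E set21.
  have /set2P[/eqP|->] // : q \in [set p'; q'] by rewrite -E set22.
  by rewrite (negbTE qp).
by rewrite (negbTE pq).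
Qed.

Lemma set2_neq (T : finType) (p q p' q' : T) :
  p != p' -> p != q' -> [set p; q] != [set p'; q'].
Proof.
by move=> h h'; apply: contraNneq h => E; have := set21 p q;
  rewrite E !inE (negbTE h') orbF.
Qed.

Lemma uniq_stream : uniq stream.
Proof.
have neq u v : u != v -> phi u != phi v by rewrite (inj_eq phi_inj).
have inj1 : injective edge1.
  move=> [c l] [c' l'] /set2_inj [||/phi_inj[->] /phi_inj[->] //]; exact: neq.
have inj2 : injective edge2.
  move=> [c l] [c' l'] /set2_inj [||/phi_inj[->] /phi_inj[->] //]; exact: neq.
have inj3 : injective edge3.
  move=> [c l] [c' l'] /set2_inj [||/phi_inj[->] /phi_inj[->] //]; exact: neq.
rewrite !cat_uniq !map_inj_uniq ?enum_uniq //= !andbT.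
apply/andP; split.
  apply/hasPn => e /mapP[q _ ->]; apply/mapP => -[q' _ /eqP]; apply/negP.
  by rewrite /edge1 /edge2 setUC set2_neq // neq.
apply/hasPn => e /mapP[q _ ->]; rewrite mem_cat; apply/norP; split.
  apply/mapP => -[q' _ /eqP]; apply/negP.
  by rewrite /edge1 /edge3 setUC set2_neq // neq.
apply/mapP => -[q' _ /eqP]; apply/negP.
by rewrite /edge2 /edge3 set2_neq // neq.
Qed.

Lemma streamP (e : {set V}) : e \in [set e in stream] -> #|e| = 2%N.
Proof.
rewrite inE => /mem_stream[u [v [uv ->]]]; rewrite cards2 (inj_eq phi_inj).
by have [E|//] := eqVneq u v; move: uv; rewrite E adj_irr.
Qed.

Definition tripartite : sgraph V := SGraph streamP.

Lemma perm_stream : perm_eq stream (enum (edges tripartite)).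
Proof.
apply: uniq_perm; rewrite ?uniq_stream ?enum_uniq // => e.
by rewrite mem_enum inE.
Qed.

Lemma card_edges_tripartite : #|edges tripartite| = (#|E1| + #|E2| + #|E3|)%N.
Proof.
by rewrite cardE -(perm_size perm_stream) !size_cat !size_map -!cardE.
Qed.

Definition tri (q : C * L * M) : {set V} :=
  [set phi (inl (inl q.1.1)); phi (inl (inr q.1.2)); phi (inr q.2)].

Definition triples : {set C * L * M} :=
  [set q | [&& (q.1.1, q.1.2) \in E1, (q.1.1, q.2) \in E2 & (q.1.2, q.2) \in E3]].

Lemma adjP u v : ([set phi u; phi v] \in edges tripartite) = adj u v.
Proof.
rewrite inE; apply/mem_stream/idP => [[u' [v' [uv' E]]]|uv]; last by exists u, v.
have ne : u' != v' by apply/eqP => E'; move: uv'; rewrite E' adj_irr.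
have /set2P[/phi_inj uu|/phi_inj uv] : phi u \in [set phi u'; phi v'] by rewrite -E set21.
  have /set2P[/phi_inj vu|/phi_inj vv] : phi v' \in [set phi u; phi v] by rewrite E set22.
    by move: ne; rewrite vu uu eqxx.
  by rewrite uu -vv.
have /set2P[/phi_inj vu|/phi_inj vv] : phi u' \in [set phi u; phi v] by rewrite E set21.
  by move: ne; rewrite vu uv eqxx.
by rewrite uv -vv adj_sym.
Qed.

Lemma tri_inj : injective tri.
Proof.
move=> [[c l] r] [[c' l'] r'] E.
have h u : phi u \in tri (c, l, r) ->
    [|| u == inl (inl c'), u == inl (inr l') | u == inr r'].
  by rewrite E !inE !(inj_eq phi_inj) orbA.
have := h (inl (inl c)); have := h (inl (inr l)); have := h (inr r).
rewrite !inE !eqxx !orbT /= => /(_ isT)/eqP[->] /(_ isT).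
by rewrite orbF => /eqP[->] /(_ isT); rewrite orbF => /eqP[->].
Qed.

(** Adjacent vertices lie in different classes, so a triangle has one vertex in each; the six cases
    left in the proof are the orders in which the classes may occur. *)
Lemma triangles_tripartite : triangles tripartite = tri @: triples.
Proof.
apply/setP => t; apply/idP/imsetP.
  rewrite inE => /andP[/eqP t3 /forallP te].
  have edge p q : p \in t -> q \in t -> p != q -> [set p; q] \in edges tripartite.
    move=> pt qt pq; apply: (implyP (te _)); rewrite subUset !sub1set pt qt /=.
    by rewrite cards2 pq.
  have [p pt] : exists p, p \in t by apply/card_gt0P; rewrite t3.
  have /cards2P[q [r [qr tE]]] : #|t :\ p| == 2%N.
    by move: t3; rewrite (cardsD1 p t) pt add1n => -[->].
  have [/setD1P[qp qt] /setD1P[rp rt]] : q \in t :\ p /\ r \in t :\ p.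
    by rewrite tE set21 set22.
  have {}tE : t = [set p; q; r] by rewrite -(setD1K pt) tE setUA.
  rewrite eq_sym in qp; rewrite eq_sym in rp.
  have pq := edge _ _ pt qt qp; have prr := edge _ _ pt rt rp.
  have qrr := edge _ _ qt rt qr.
  move: (pq); rewrite inE => /mem_stream[u0 [v0 [_ Epq]]].
  move: (prr); rewrite inE => /mem_stream[u1 [v1 [_ Epr]]].
  have [u up] : exists u, p = phi u.
    by have := set21 p q; rewrite Epq => /set2P[] ->; [exists u0|exists v0].
  have [v vq] : exists u, q = phi u.
    by have := set22 p q; rewrite Epq => /set2P[] ->; [exists u0|exists v0].
  have [w wr] : exists u, r = phi u.
    by have := set22 p r; rewrite Epr => /set2P[] ->; [exists u1|exists v1].
  move: pq prr qrr; rewrite up vq wr !adjP tE up vq wr.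
  case: u {up} => [[c|l]|m]; case: v {vq} => [[c'|l']|m'] //=;
    case: w {wr} => [[c''|l'']|m''] //= h1 h2 h3.
  - by exists (c, l', m''); rewrite ?inE ?h1 ?h2.
  - by exists (c, l'', m'); rewrite ?inE ?h1 ?h2 // /tri setUAC.
  - by exists (c', l, m''); rewrite ?inE ?h1 ?h2 ?h3 // /tri [X in X :|: _]setUC.
  - by exists (c'', l, m'); rewrite ?inE ?h1 ?h2 ?h3 // /tri setUC setUA.
  - by exists (c', l'', m); rewrite ?inE ?h1 ?h2 ?h3 // /tri [RHS]setUC setUA.
  - exists (c'', l', m); rewrite ?inE ?h1 ?h2 ?h3 // /tri setUC setUA.
    by rewrite setUAC.
case=> -[[c l] m]; rewrite inE /= => /and3P[h1 h2 h3] ->.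
rewrite inE; apply/andP; split.
  by rewrite /tri -setUA cardsU1 cards2 !inE !(inj_eq phi_inj).
apply/forallP => e; apply/implyP => /andP[et /cards2P[p [q [pq E]]]].
move: et; rewrite E subUset !sub1set /tri !inE => /andP[hp hq].
have edge u v : adj u v -> [set phi u; phi v] \in stream.
  by rewrite -adjP inE.
case/orP: hp => [/orP[]|] /eqP hp; case/orP: hq => [/orP[]|] /eqP hq;
  rewrite hp hq ?eqxx // in pq *; exact: edge.
Qed.

Lemma card_triangles_tripartite : #|triangles tripartite| = #|triples|.
Proof. by rewrite triangles_tripartite card_imset //; exact: tri_inj. Qed.

(** An edge fixes two vertices of its triangles; the third is an [E3]-neighbour of one of them or,
    for an edge of [E3], a centre. *)
Lemma tri_edge_tripartite (K : nat) e :
  (#|C| <= K)%N -> (forall l, #|[set r | (l, r) \in E3]| <= K)%N ->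
  (forall r, #|[set l | (l, r) \in E3]| <= K)%N ->
  e \in edges tripartite -> (tri_edge tripartite e <= K)%N.
Proof.
move=> CK lK rK; rewrite inE => /mem_stream[u [v [uv ->]]].
wlog : u v uv / match u, v with
  | inl (inl _), inl (inr _) | inl (inl _), inr _ | inl (inr _), inr _ => true
  | _, _ => false end.
  move=> H; have vu : adj v u by rewrite adj_sym.
  have H1 := H u v uv; have := H v u vu; rewrite [[set phi v; phi u]]setUC.
  by case: u v uv vu H1 {H} => [[c|l]|r] [[c'|l']|r'] //= _ _ H1 H2;
    first [exact: H1 | exact: H2].
rewrite /tri_edge triangles_tripartite.
case: u v uv => [[c|l]|r] [[c'|l']|r'] //= uv _.
- apply: leq_trans (lK l').
  rewrite -(card_imset _ (_ : injective (fun r => tri (c, l', r)))).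
    apply/subset_leq_card/subsetP => s; rewrite inE => /andP[/imsetP[[[c1 l1] r1]]].
    rewrite inE /= => /and3P[_ _ h3] -> /=.
    rewrite subUset !sub1set !inE !(inj_eq phi_inj) /=.
    rewrite !orbF => /andP[/eqP[cE] /eqP[lE]]; rewrite cE lE.
    by apply/imsetP; exists r1; rewrite ?inE ?lE.
  by move=> r r' /tri_inj[].
- apply: leq_trans (rK r').
  rewrite -(card_imset _ (_ : injective (fun l => tri (c, l, r')))).
    apply/subset_leq_card/subsetP => s; rewrite inE => /andP[/imsetP[[[c1 l1] r1]]].
    rewrite inE /= => /and3P[_ _ h3] -> /=.
    rewrite subUset !sub1set !inE !(inj_eq phi_inj) /=.
    rewrite !orbF => /andP[/eqP[cE] /eqP[lE]]; rewrite cE lE.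
    by apply/imsetP; exists l1; rewrite ?inE ?lE.
  by move=> l l' /tri_inj[].
- apply: leq_trans CK.
  rewrite -cardsT -(card_imset _ (_ : injective (fun c => tri (c, l, r')))).
    apply/subset_leq_card/subsetP => s; rewrite inE => /andP[/imsetP[[[c1 l1] r1]]].
    rewrite inE /= => _ -> /=.
    rewrite subUset !sub1set !inE !(inj_eq phi_inj) /=.
    rewrite !orbF => /andP[/eqP[cE] /eqP[lE]]; rewrite cE lE.
    by apply/imsetP; exists c1; rewrite ?inE.
  by move=> c c' /tri_inj[].
Qed.

End Tripartite.

(** * The reduction *)

Section Gadget.
Variables (n t k P : nat).
Local Notation blob := ('I_n * bool * 'I_k)%type.
Implicit Types (x y : {ffun 'I_n -> bool}) (w : {ffun 'I_P -> bool}).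

Definition star x : {set 'I_t * blob} :=
  [set (q.1, (q.2.1, x q.2.1, q.2.2)) | q in [set: 'I_t * ('I_n * 'I_k)]].

(** Both labels [q.1.2] are used because Bob does not know Alice's bits; the number of edges is then
    independent of all inputs. *)
Definition cross (a b : 'I_P -> 'I_n) w : {set blob * blob} :=
  [set ((a q.1.1, q.1.2, q.2.1), (b q.1.1, q.1.2 (+) w q.1.1, q.2.2))
     | q in [set: ('I_P * bool) * ('I_k * 'I_k)]].

Lemma in_star x c l : ((c, l) \in star x) = (l.1.2 == x l.1.1).
Proof.
case: l => [[i u] h] /=; apply/imsetP/eqP => [[q _ [_ -> -> _]] //|->].
by exists (c, (i, h)).
Qed.

Lemma card_star x : #|star x| = (t * (n * k))%N.
Proof.
rewrite card_imset ?cardsT ?card_prod ?card_ord //.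
by move=> [c [i h]] [c' [i' h']] /= [-> -> _ ->].
Qed.

Variables a b : 'I_P -> 'I_n.
Hypotheses (aI : injective a) (bI : injective b).

Lemma card_cross w : #|cross a b w| = (P * 2 * (k * k))%N.
Proof.
rewrite card_imset ?cardsT ?card_prod ?card_ord ?card_bool //.
by move=> [[j u] [h g]] [[j' u'] [h' g']] /= [/aI -> -> -> _ _ ->].
Qed.

Lemma cross_degl w l : (#|[set r | (l, r) \in cross a b w]| <= k)%N.
Proof.
have [->|/set0Pn[r0]] := eqVneq [set r | (l, r) \in cross a b w] set0.
  by rewrite cards0.
rewrite inE => /imsetP[[[j u] [h g]] _ /= [El _]].
rewrite -[X in (_ <= X)%N]card_ord -cardsT.
apply: leq_trans (leq_imset_card (fun i => (b j, u (+) w j, i)) _).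
apply/subset_leq_card/subsetP => r; rewrite inE => /imsetP[[[j' u'] [h' g']] _ /=].
by rewrite El => -[/aI <- <- _ ->]; apply/imsetP; exists g'.
Qed.

Lemma cross_degr w r : (#|[set l | (l, r) \in cross a b w]| <= k)%N.
Proof.
have [->|/set0Pn[l0]] := eqVneq [set l | (l, r) \in cross a b w] set0.
  by rewrite cards0.
rewrite inE => /imsetP[[[j u] [h g]] _ /= [_ Er]].
rewrite -[X in (_ <= X)%N]card_ord -cardsT.
apply: leq_trans (leq_imset_card (fun i => (a j, u, i)) _).
apply/subset_leq_card/subsetP => l; rewrite inE => /imsetP[[[j' u'] [h' g']] _ /=].
rewrite Er => -[-> /bI <-] /addIb -> _.
by apply/imsetP; exists h'.
Qed.

Lemma card_triples_yes x y :
  #|triples (star x) (star y) (cross a b (parity a b (x, y)))| = (t * P * (k * k))%N.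
Proof.
pose g (q : 'I_t * 'I_P * ('I_k * 'I_k)) : 'I_t * blob * blob :=
  (q.1.1, (a q.1.2, x (a q.1.2), q.2.1), (b q.1.2, y (b q.1.2), q.2.2)).
have gI : injective g.
  by move=> [[c j] [h h']] [[c' j'] [i i']] /= [-> /aI -> _ -> _ _ ->].
rewrite (_ : triples _ _ _ = g @: [set: _]).
  by rewrite card_imset ?cardsT ?card_prod ?card_ord.
apply/setP => -[[c [[i u] h]] [[i' u'] h']]; rewrite inE /= !in_star /=.
apply/and3P/imsetP => [[/eqP -> /eqP -> /imsetP[[[j v] [p q]] _ /= [-> _ -> -> _ ->]]]|].
  by exists (c, j, (p, q)).
case=> -[[c' j] [p q]] _ [_ -> -> -> -> -> ->]; split=> //.
apply/imsetP; exists (j, x (a j), (p, q)); rewrite ?in_setT //=.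
by rewrite ffunE /= addbA addbb.
Qed.

(** A triangle would need the labels [x (a j)] and [y (b j)] to differ by the flipped parity. *)
Lemma card_triples_no x y :
  #|triples (star x) (star y) (cross a b (negf (parity a b (x, y))))| = 0%N.
Proof.
apply/eqP; rewrite cards_eq0; apply/eqP/setP => -[[c [[i u] h]] [[i' u'] h']].
rewrite !inE /= !in_star /=; apply/negP => /and3P[/eqP -> /eqP -> /imsetP].
move=> [[[j v] [p q]] _ /= [-> <- _ ->]]; rewrite !ffunE /=.
by case: (x _); case: (y _).
Qed.

End Gadget.

(** * From streaming algorithms to one-way protocols *)

Lemma run_from_cat (R : realType) (V : finType) (s : nat) (A : streaming_alg R V s)
    (w : seed A) O i mem es es' :
  run_from w O i mem (es ++ es') =
  run_from w O (i + size es) (run_from w O i mem es) es'.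
Proof.
elim: es i mem => [|e es IH] i mem /=; first by rewrite addn0.
by rewrite IH addSnnS.
Qed.

Lemma card_le_inj (T V : finType) : (#|T| <= #|V|)%N -> exists f : T -> V, injective f.
Proof.
move=> TV; exists (fun u => enum_val (widen_ord TV (enum_rank u))).
by move=> u v /enum_val_inj/(congr1 val) /= /val_inj/enum_rank_inj.
Qed.

(** Alice's message is the memory after her edges. As the oracle is constantly [false], both players
    can simulate it without knowing the whole graph. Correctness gives an advantage of at least
    [2/3 - 1/3], against [hidden_matching]. *)
Lemma space_bound (R : realType) (n t k P : nat) (c : R) (V : finType) (s : nat)
    (A : streaming_alg R V s) :
  (0 < t)%N -> (0 < k)%N -> (0 < P)%N -> (2 * P <= n)%N ->
  t%:R < (t * P * (k * k))%:R / c -> k%:R < (t * P * (k * k))%:R / c ->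
  (2 * (t * (n * k) + t * (n * k) + P * 2 * (k * k)) <= #|V|)%N ->
  distinguishes A (t * (n * k) + t * (n * k) + P * 2 * (k * k)) (t * P * (k * k)) c ->
  n%:R ^+ 2 <= 72 * 256 * s.+1%:R ^+ 2 * P%:R :> R.
Proof.
move=> t0 k0 P0 Pn tc kc cV dist; rewrite leNgt; apply/negP => hs.
have n0 : (0 < n)%N by apply: leq_trans Pn; rewrite muln_gt0.
pose blob := ('I_n * bool * 'I_k)%type.
have [phi phiI] : exists phi : 'I_t + blob + blob -> V, injective phi.
  apply: card_le_inj; apply: leq_trans cV.
  by rewrite !card_sum !card_prod !card_ord card_bool; nia.
pose O0 := fun _ : {set V} => false.
pose alice (z : {ffun 'I_n -> bool} * {ffun 'I_n -> bool}) :=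
  stream1 phi (star t k z.1) ++ stream2 phi (star t k z.2).
pose msg (w : seed A) z := run_from w O0 0 (init w) (alice z).
have cardM : #|{: s.-tuple bool}| = (2 ^ s)%N by rewrite card_tuple card_bool.
have [a [b [aI bI]]] := @hidden_matching R 'I_n 'I_n (seed A) (s.-tuple bool) n P s
  (@seed_prob _ _ _ A) msg (card_ord n) (card_ord n) n0 Pn hs cardM
  (@seed_prob_ge0 _ _ _ A) (seed_prob_sum1 A).
(* Bob resumes at the position where Alice stopped, which is the same for all her inputs. *)
pose D (w : seed A) mem v :=
  output w O0 (run_from w O0 (t * (n * k) + t * (n * k)) mem
    (stream3 phi (cross k a b v))).
move=> /(_ D); apply/negP; rewrite -leNgt.
have size_alice z : size (alice z) = (t * (n * k) + t * (n * k))%N.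
  by rewrite size_cat !size_map -!cardE !card_star.
pose G z v := tripartite phiI (star t k z.1) (star t k z.2) (cross k a b v).
have oracle z v : heavy_oracle (G z v) (t * P * (k * k)) c = O0.
  apply: funext => e; rewrite /heavy_oracle /O0; apply/negP => /andP[eG].
  apply/negP; rewrite -ltNge.
  apply: (@le_lt_trans _ _ (maxn t k)%:R).
    rewrite ler_nat tri_edge_tripartite // ?card_ord ?leq_maxl // => l.
      by apply: leq_trans (leq_maxr t k); exact: cross_degl.
    by apply: leq_trans (leq_maxr t k); exact: cross_degr.
  by rewrite /maxn; case: ifP.
have cardG z v : #|edges (G z v)| = (t * (n * k) + t * (n * k) + P * 2 * (k * k))%N.
  by rewrite card_edges_tripartite !card_star card_cross.
have ansE w z v : answer w O0 (stream phi (star t k z.1) (star t k z.2) (cross k a b v)) =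
    D w (msg w z) v.
  by rewrite /answer /stream run_from_cat -/(alice z) add0n size_alice.
have sumE z v : \sum_w seed_prob w * (D w (msg w z) v)%:R =
    prob_answer A O0 (stream phi (star t k z.1) (star t k z.2) (cross k a b v)) true.
  rewrite /prob_answer [RHS]big_mkcond; apply: eq_bigr => w _; rewrite ansE.
  by case: (D _ _ _); rewrite ?mulr1 ?mulr0.
have sumE' es : prob_answer A O0 es true + prob_answer A O0 es false = 1.
  rewrite /prob_answer -(seed_prob_sum1 A) [RHS](bigID (fun w => answer w O0 es == true)) /=.
  by congr (_ + _); apply: eq_bigl => w; case: answer.
rewrite -[3^-1](@mean_cst R ({ffun 'I_n -> bool} * {ffun 'I_n -> bool})%type); last first.
  by rewrite card_prod muln_gt0 !card_cube.
apply: ler_mean => z.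
rewrite (eq_bigr (fun w => seed_prob w * (D w (msg w z) (parity a b z))%:R -
   seed_prob w * (D w (msg w z) (negf (parity a b z)))%:R)); last first.
  by move=> w _; rewrite mulrBr.
rewrite sumrB !sumE.
have [_] := dist (G z (parity a b z)) _ (cardG _ _) (perm_stream phiI _ _ _).
rewrite card_triangles_tripartite {1}[z]surjective_pairing
  card_triples_yes // oracle => /(_ erefl) yes.
have [+ _] := dist (G z (negf (parity a b z))) _ (cardG _ _) (perm_stream phiI _ _ _).
rewrite card_triangles_tripartite {1}[z]surjective_pairing
  card_triples_no // oracle => /(_ erefl) no.
have := sumE' (stream phi (star t k z.1) (star t k z.2) (cross k a b (negf (parity a b z)))).
by move: yes no; lra.
Qed.

Lemma requires_space_gadget (R : realType) (n t k P : nat) (c : R) :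
  (0 < t)%N -> (0 < k)%N -> (0 < P)%N -> (2 * P <= n)%N ->
  t%:R < (t * P * (k * k))%:R / c -> k%:R < (t * P * (k * k))%:R / c ->
  272 * Num.sqrt P%:R <= n%:R :> R ->
  requires_space (t * (n * k) + t * (n * k) + P * 2 * (k * k)) (t * P * (k * k)) c
    (n%:R / (272 * Num.sqrt P%:R)).
Proof.
move=> t0 k0 P0 Pn tc kc nP V s A cV dist.
have := space_bound t0 k0 P0 Pn tc kc cV dist.
set r := Num.sqrt P%:R in nP *.
have r2 : r ^+ 2 = P%:R by rewrite sqr_sqrtr.
have r0 : 0 < r by rewrite sqrtr_gt0 ltr0n.
rewrite -r2 => h.
(* [136 ^ 2 = 18496] exceeds [72 * 256 = 18432]. Below, [272 * r <= n] forces [s >= 1], hence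
   [s + 1 <= 2 * s]. *)
have h1 : n%:R <= 136 * s.+1%:R * r.
  rewrite -(@ler_pXn2r _ 2%N) // ?nnegrE ?mulr_ge0 // ?(ltW r0) //.
  have : 0 <= s.+1%:R ^+ 2 * r ^+ 2 :> R by rewrite -exprMn sqr_ge0.
  by rewrite !exprMn; move: h; nra.
have s1 : (0 < s)%N.
  have : 272 * r <= 136 * s.+1%:R * r by apply: le_trans h1.
  rewrite ler_pM2r // -natrM ler_nat; lia.
have s1R : 1 <= s%:R :> R by rewrite ler1n.
rewrite ler_pdivrMr ?mulr_gt0 //; apply: (le_trans h1).
by rewrite -natr1; nra.
Qed.

(** * Choice of the parameters *)

Lemma within_factorI (R : realType) (C : R) (x y : nat) :
  1 <= C -> x%:R <= y%:R :> R -> y%:R <= C * x%:R -> within_factor C x y.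
Proof.
move=> C1 xy yC; rewrite /within_factor yC andbT (le_trans _ xy) //.
by rewrite ler_piMl // invf_le1 //; lra.
Qed.

Lemma ceil_nat (R : realType) (x : R) : 0 < x ->
  exists2 u : nat, (0 < u)%N & x <= u%:R <= x + 1.
Proof.
move=> x0; exists (Num.truncn x).+1 => //.
have /andP[h1 h2] := truncn_itv (ltW x0).
by rewrite (ltW h2) -natr1 lerD2r.
Qed.

Lemma sparse_lower_bound (R : realType) (m T : nat) (c : R) :
  0 < c -> 1 < T%:R / c -> (T <= m)%N ->
  exists m' T' : nat,
    within_factor (546 : R) m m' /\ within_factor (546 : R) T T' /\ 1 < T'%:R / c /\
    requires_space m' T' c (1 * (m%:R / Num.sqrt T%:R)).
Proof.
move=> c0 Tc Tm.
have T0 : (0 < T)%N.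
  by rewrite lt0n; apply/eqP => E; move: Tc; rewrite E mul0r ltr10.
have m1 : 1 <= m%:R :> R by rewrite ler1n (leq_trans T0).
have TmR : T%:R <= m%:R :> R by rewrite ler_nat.
have T1 : 1 <= T%:R :> R by rewrite ler1n.
have r2 : Num.sqrt T%:R ^+ 2 = T%:R :> R by rewrite sqr_sqrtr.
have r0 : 0 < Num.sqrt T%:R :> R by rewrite sqrtr_gt0 ltr0n.
have rm : Num.sqrt T%:R <= m%:R :> R by clear -r2 TmR m1; nra.
(* Taking [n = 272 * m] cancels the constant of the space bound; then [m' = 544 * m + 2 * T] is at
   most [546 * m], and [T' = T]. *)
exists (1 * (272 * m * 1) + 1 * (272 * m * 1) + T * 2 * (1 * 1))%N,
  (1 * T * (1 * 1))%N.
have TE : (1 * T * (1 * 1))%N = T by rewrite !muln1 mul1n.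
split; last split; last split; rewrite ?TE //.
- by clear -TmR m1 T1; apply: within_factorI; rewrite ?muln1 ?mul1n ?natrD ?natrM; lra.
- by clear -T1; apply: within_factorI; lra.
rewrite mul1r (_ : m%:R / _ = (272 * m)%:R / (272 * Num.sqrt T%:R)); last first.
  by rewrite natrM; field; rewrite gt_eqF.
rewrite -{2}TE; apply: requires_space_gadget; rewrite ?TE //.
  by rewrite leq_mul.
by rewrite natrM ler_pM2l.
Qed.

Lemma ceil_le_mul (R : realType) (b x y : R) : 0 < b -> b <= x -> y <= x + 1 ->
  y <= (1 + b^-1) * x.
Proof.
move=> b0 bx yx; apply: (le_trans yx).
by rewrite mulrDl mul1r lerD2l ler_pdivlMl ?mulr1.
Qed.

Lemma dense_lower_bound (R : realType) (K L M : R) : 0 < K -> 0 < L -> 0 < M ->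
  exists2 C : R, 0 < C & forall (m T : nat) (c : R),
    (0 < m)%N -> 0 < c -> c <= K * m%:R ->
    c * Num.sqrt m%:R <= K / L * T%:R ->
    L * m%:R <= T%:R -> T%:R <= M * (m%:R * Num.sqrt m%:R) ->
    exists m' T' : nat,
      within_factor C m m' /\ within_factor C T T' /\ 1 < T'%:R / c /\
      requires_space m' T' c (m%:R * Num.sqrt m%:R / T%:R).
Proof.
move=> K0 L0 M0.
have KL0 : 0 < K / L by rewrite divr_gt0.
(* Enlarging [k] by the constant [A0] makes both inequalities on [c] strict. *)
have [A0 _ /andP[hA _]] : exists2 u : nat, (0 < u)%N &
    K + K / L + 1 <= u%:R <= K + K / L + 1 + 1 by apply: ceil_nat; rewrite !addr_gt0.
have [AK AKL A1] : [/\ K < A0%:R, K / L < A0%:R & 1 <= A0%:R :> R].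
  by split; clear -hA KL0 K0; lra.
have A0R : 0 < A0%:R :> R by apply: lt_trans AK.
have AA : 1 <= A0%:R ^+ 2 :> R by rewrite exprn_ege1.
pose l := 1 + L^-1; pose g := 1 + M.
have l1 : 1 <= l by rewrite lerDl invr_ge0 ltW.
have g1 : 1 <= g by rewrite lerDl ltW.
have l0 : 0 < l by apply: lt_le_trans l1.
have g0 : 0 < g by apply: lt_le_trans g1.
(* The first term pays for Alice's edges; the second covers both Bob's edges and [T' / T]. *)
pose C := 544 * (2 * A0%:R * (g * l)) + 8 * A0%:R ^+ 2 * l.
have C8 : 8 * A0%:R ^+ 2 * l <= C.
  by rewrite /C lerDr !mulr_ge0 // ltW.
have C1 : 1 <= C by apply: le_trans C8; clear -AA l1; nra.
exists C; first exact: lt_le_trans C1.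
move=> m T c m0 c0 cm cT LmT.
set r := Num.sqrt m%:R in cT *; move=> TM.
have mR : 0 < m%:R :> R by rewrite ltr0n.
have mn0 : m%:R != 0 :> R by rewrite gt_eqF.
have T0 : 0 < T%:R :> R by apply: lt_le_trans LmT; rewrite mulr_gt0.
have Tn0 : T%:R != 0 :> R by rewrite gt_eqF.
have r2 : r ^+ 2 = m%:R by rewrite sqr_sqrtr.
have r1 : 1 <= r by rewrite -sqrtr1 ler_wsqrtr ?ler1n.
have r0 : 0 < r by apply: lt_le_trans r1.
have Tm0 : 0 < T%:R / m%:R :> R by rewrite divr_gt0.
have mT0 : 0 < m%:R * r / T%:R by rewrite divr_gt0 // mulr_gt0.
(* Rounded up: [u] from [sqrt m], [t] from [T / m], [N] from [m^(3/2) / T]. The last two are bounded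
   below by [L] and [1 / M], so rounding costs at most the factors [l] and [g]. *)
have [u u0 /andP[u1 u2]] := ceil_nat r0.
have [t t0 /andP[t1 t2]] := ceil_nat Tm0.
have [N N0 /andP[N1 N2]] := ceil_nat mT0.
have u3 : u%:R <= 2 * r by clear -u2 r1; lra.
have t3 : t%:R <= l * (T%:R / m%:R).
  by apply: ceil_le_mul t2 => //; rewrite ler_pdivlMr.
have N3 : N%:R <= g * (m%:R * r / T%:R).
  rewrite /g -[M]invrK; apply: ceil_le_mul N2; first by rewrite invr_gt0.
  by rewrite ler_pdivlMr // ler_pdivrMl.
pose k := (A0 * u)%N.
have k0 : (0 < k)%N by rewrite muln_gt0 u0 -(ltr0n R) A0R.
have kE : k%:R = A0%:R * u%:R :> R by rewrite natrM.
have tR : 0 < t%:R :> R by rewrite ltr0n.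
have kR : 0 < k%:R :> R by rewrite ltr0n.
have mk : A0%:R ^+ 2 * m%:R <= k%:R ^+ 2 :> R.
  by rewrite kE exprMn ler_pM2l ?exprn_gt0 // -r2 ler_pXn2r ?nnegrE // ltW.
have km : k%:R ^+ 2 <= 4 * A0%:R ^+ 2 * m%:R :> R.
  rewrite kE exprMn -r2 (_ : 4 * _ * _ = A0%:R ^+ 2 * (2 * r) ^+ 2); last by ring.
  by rewrite ler_pM2l ?exprn_gt0 // ler_pXn2r ?nnegrE // mulr_ge0 // ltW.
have ck2 : c < k%:R ^+ 2.
  apply: lt_le_trans mk; apply: (le_lt_trans cm); rewrite ltr_pM2r //.
  by apply: (lt_le_trans AK); rewrite expr2 ler_peMl // ltW.
have ckt : c < k%:R * t%:R.
  rewrite -(ltr_pM2r r0); apply: (le_lt_trans cT).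
  apply: (@lt_le_trans _ _ (A0%:R * T%:R)); first by rewrite ltr_pM2r.
  rewrite kE -!mulrA ler_pM2l // [t%:R * r]mulrC mulrA.
  have -> : T%:R = r * r * (T%:R / m%:R) by rewrite -expr2 r2 mulrC divfK.
  apply: ler_pM => //; [by rewrite mulr_ge0 // ltW | exact: ltW | by rewrite ler_pM2r].
have TE : (t * 1 * (k * k))%:R = t%:R * k%:R ^+ 2 :> R.
  by rewrite muln1 !natrM expr2.
have tk2 : t%:R < (t * 1 * (k * k))%:R / c.
  by rewrite TE ltr_pdivlMr // ltr_pM2l.
have kt2 : k%:R < (t * 1 * (k * k))%:R / c.
  by rewrite TE ltr_pdivlMr // expr2 mulrCA ltr_pM2l // mulrC.
exists (t * (272 * N * k) + t * (272 * N * k) + 1 * 2 * (k * k))%N,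
  (t * 1 * (k * k))%N.
split; last split; last split.
- have mE : (t * (272 * N * k) + t * (272 * N * k) + 1 * 2 * (k * k))%:R =
      544 * (N%:R * t%:R * k%:R) + 2 * k%:R ^+ 2 :> R.
    by rewrite !natrD !natrM expr2; ring.
  have ge0 : 0 <= N%:R * t%:R * k%:R :> R by rewrite !mulr_ge0.
  apply: within_factorI; rewrite ?mE //.
    apply: (le_trans _ (le_trans mk _)); first by rewrite ler_peMl // ltW.
    by have := sqr_ge0 (k%:R : R); clear -ge0; lra.
  have NT : N%:R * t%:R <= g * l * r.
    have -> : g * l * r = g * (m%:R * r / T%:R) * (l * (T%:R / m%:R)).
      by clear -mn0 Tn0; field; rewrite mn0 Tn0.
    by rewrite ler_pM.
  have NTk : N%:R * t%:R * k%:R <= 2 * A0%:R * (g * l) * m%:R.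
    have -> : 2 * A0%:R * (g * l) * m%:R = g * l * r * (A0%:R * (2 * r)).
      by rewrite -r2; ring.
    by rewrite ler_pM ?mulr_ge0 // kE ler_pM2l.
  have kl : 8 * A0%:R ^+ 2 * m%:R <= 8 * A0%:R ^+ 2 * l * m%:R.
    apply: ler_wpM2r => //; apply: ler_peMr => //.
    by rewrite mulr_ge0 // sqr_ge0.
  by rewrite /C; clear -NTk kl km; lra.
- apply: within_factorI; rewrite ?TE //.
    rewrite -[leLHS](divfK mn0); apply: ler_pM => //; first exact: ltW.
    by apply: le_trans mk; rewrite ler_peMl.
  apply: (@le_trans _ _ ((l * (T%:R / m%:R)) * (4 * A0%:R ^+ 2 * m%:R))).
    by apply: ler_pM => //; exact: sqr_ge0.
  have -> : l * (T%:R / m%:R) * (4 * A0%:R ^+ 2 * m%:R) = 4 * A0%:R ^+ 2 * l * T%:R.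
    by clear -mn0; field.
  rewrite ler_pM2r //; apply: le_trans C8.
  by rewrite ler_pM2r // ler_pM2r ?exprn_gt0 // ler_nat.
- by apply: le_lt_trans tk2; rewrite ler1n.
move=> V s A cV dist; apply: (le_trans N1).
have := requires_space_gadget t0 k0 (ltn0Sn 0) _ tk2 kt2 _ cV dist.
rewrite sqrtr1 mulr1 natrM mulrAC divff ?mul1r; last by rewrite pnatr_eq0.
apply; first by clear -N0; lia.
by rewrite ler_peMr // ler1n.
Qed.

Unset Implicit Arguments.

Theorem theoremC2 (R : realType) (q K : R) (hq0 : 0 <= q) (hq1 : q < 1)
    (hK : 0 < K) :
  (exists C kappa : R, 0 < C /\ 0 < kappa /\
     forall (m T : nat) (c : R),
       0 < c -> c <= K * m%:R `^ q -> 1 < T%:R / c ->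
       (T <= m)%N ->
       exists m' T' : nat,
         within_factor C m m' /\ within_factor C T T' /\ 1 < T'%:R / c /\
         requires_space m' T' c (kappa * (m%:R / Num.sqrt T%:R)))
  /\
  (forall delta L M : R,
     Num.max 0 (q - 1 / 2) <= delta -> delta < 1 / 2 -> 0 < L -> 0 < M ->
     exists C kappa : R, 0 < C /\ 0 < kappa /\
     forall (m T : nat) (c : R),
       0 < c -> c <= K * m%:R `^ q -> 1 < T%:R / c ->
       L * m%:R `^ (1 + delta) <= T%:R -> T%:R <= M * m%:R `^ (3 / 2) ->
       exists m' T' : nat,
         within_factor C m m' /\ within_factor C T T' /\ 1 < T'%:R / c /\
         requires_space m' T' c (kappa * (m%:R `^ (3 / 2) / T%:R))).
Proof.
split.
  exists 546, 1; do 2 split=> //.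
  by move=> m T c c0 _; exact: sparse_lower_bound.
move=> delta L M hdelta _ L0 M0.
have [C C0 HC] := dense_lower_bound hK L0 M0.
exists C, 1; do 2 split=> //.
move=> m T c c0 cK Tc LT TM.
have T0 : 0 < T%:R :> R.
  by rewrite lt_def ler0n andbT; apply/eqP => E; move: Tc; rewrite E mul0r ltr10.
have m0 : (0 < m)%N.
  rewrite lt0n; apply/eqP => E; move: TM; rewrite E powR0 ?mulr0 ?leNgt ?T0 //.
  by rewrite mulf_neq0 ?invr_eq0 ?pnatr_eq0.
have m1 : 1 <= m%:R :> R by rewrite ler1n.
have md x y : (x + y == 0) ==> (m%:R != 0 :> R).
  by apply/implyP => _; rewrite pnatr_eq0 -lt0n.
have m32 : m%:R `^ (3 / 2) = m%:R * Num.sqrt m%:R :> R.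
  rewrite (_ : 3 / 2 = 1 + 2^-1); last by field.
  by rewrite powRD ?md ?powRr1 ?powR12_sqrt.
rewrite m32 in TM *; rewrite mul1r.
move: hdelta; rewrite ge_max => /andP[delta0 hq].
apply: HC => //.
- apply: (le_trans cK); rewrite ler_pM2l // -[leRHS]powRr1 //.
  by apply: ler_powR => //; exact: ltW.
(* Since [q - 1/2 <= delta], [m^q * sqrt m] is at most [m^(1 + delta)], hence at most [T / L]. *)
- apply: (le_trans (ler_wpM2r _ cK)); first exact: sqrtr_ge0.
  rewrite -!mulrA ler_pM2l // ler_pdivlMl //.
  apply: le_trans LT; rewrite ler_pM2l // -powR12_sqrt // -powRD ?md //.
  by apply: ler_powR => //; clear -hq; lra.
apply: le_trans LT; rewrite ler_pM2l // -[leLHS]powRr1 //.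
by apply: ler_powR => //; rewrite lerDl.
Qed.
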